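(* Let $\Sigma$ be a planar model with $T$-invariant ergodic selection measure $\mathbb P$. Then for every $\varepsilon,\delta>0$ and $q\in\mathbb N$, $\lim_{n\to\infty}\mathbb P(\mathcal G^{(n)}_{\varepsilon,\delta,q})=1$, where $$\mathcal G^{(n)}_{\varepsilon,\delta,q}=\Big\{\omega:\ \mathbf P_{i=n}\Big(\tfrac1{qn}\big|H(\nu^{(\omega,n')}_{x,i}*\tau^{(\omega,n')},\mathcal D_{(q+1)n})-H(\tau^{(\omega,n')},\mathcal D_{(q+1)n})\big|<\delta\Big)>1-\varepsilon\Big\},\quad n'=n'(\omega).$$
   Context: Planar model $\Sigma$: $I$ finite; $f^{(i)}_j(z)=\lambda_iz+t^{(i)}_j$, $\lambda_i=r_i\varphi_i$, $0<r_i<1$, $|\varphi_i|=1$; positive probability vectors $p_i$; $\mathbb P$ on $\Omega=I^{\mathbb N}$, $T$ the shift. For $u\in\mathbb X^{(\omega)}_n=\prod_{j\le n}\{1,\dots,k_{\omega_j}\}$, $f^{(\omega)}_u=f^{(\omega_1)}_{u_1}\circ\dots\circ f^{(\omega_n)}_{u_n}$, $p^{(\omega)}_u=\prod_jp^{(\omega_j)}_{u_j}$. $\eta^{(\omega)}$ is the law of $\sum_{n\ge1}(\prod_{j<n}\lambda_{\omega_j})t^{(\omega_n)}_{u_n}$, $u_n$ independent with laws $p_{\omega_n}$. $\nu^{(\omega,n)}=\sum_{u\in\mathbb X^{(\omega)}_n}p^{(\omega)}_u\delta_{f^{(\omega)}_u(0)}$ and $\tau^{(\omega,n)}$ is the pushforward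 of $\eta^{(T^n\omega)}$ under $z\mapsto\lambda_{\omega_1}\cdots\lambda_{\omega_n}z$. Fix $R>0$ with $\overline{f^{(i)}_j(B(0,R))}\subset B(0,R)$ and $2R\min r_i>1/2$; $n'(\omega)$ is the natural number with $2R\prod_{i=1}^{n'}r_{\omega_i}\le2^{-n}\le2R\prod_{i=1}^{n'-1}r_{\omega_i}$. $\mathcal D_k$ dyadic squares of side $2^{-k}$, $H$ Shannon entropy (log base 2), $*$ convolution; raw component $\mu_{x,i}=\mu|_{D_i(x)}/\mu(D_i(x))$ and $\mathbf P_{i=n}(\mu_{x,i}\in A)=\mu(\{x:\mu_{x,n}\in A\})$. *)

(* Defs.v *)
(* The plane C is modelled as R * R
   (product topology / product sigma-algebra = Euclidean topology / Borel sets),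
   with complex arithmetic written out explicitly. *)
From HB Require Import structures.
From mathcomp Require Import all_boot all_order all_algebra.
From mathcomp Require Import all_classical all_reals all_analysis.

Set Implicit Arguments.
Unset Strict Implicit.
Unset Printing Implicit Defensive.

Import Order.TTheory GRing.Theory Num.Theory.
Import numFieldNormedType.Exports.
Local Open Scope classical_set_scope.
Local Open Scope ring_scope.

Section Plane.
Variable R : realType.

Definition cadd (z w : R * R) : R * R := (z.1 + w.1, z.2 + w.2).
Definition cmul (z w : R * R) : R * R :=
  (z.1 * w.1 - z.2 * w.2, z.1 * w.2 + z.2 * w.1).
Definition cscale (a : R) (z : R * R) : R * R := (a * z.1, a * z.2).
Definition cnorm (z : R * R) : R := Num.sqrt (z.1 ^+ 2 + z.2 ^+ 2).
Definition czero : R * R := (0, 0).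
Definition cone : R * R := (1, 0).

Definition eball0 (rho : R) : set (R * R) := [set z | cnorm z < rho].

(* the dyadic square of side 2^-k indexed by (a,b) : [a 2^-k,(a+1)2^-k) x [b 2^-k,(b+1)2^-k) *)
Definition dsq (k : nat) (ab : int * int) : set (R * R) :=
  [set z | Num.floor ((2:R) ^+ k * z.1) = ab.1 /\ Num.floor ((2:R) ^+ k * z.2) = ab.2].

Definition Dsq (k : nat) (x : R * R) : set (R * R) :=
  dsq k (Num.floor ((2:R) ^+ k * x.1), Num.floor ((2:R) ^+ k * x.2)).

Definition log2 (x : R) : R := ln x / ln 2.
Definition ent_term (x : R) : R := if x == 0 then 0 else - (x * log2 x).

Definition entropy (mu : set (R * R) -> \bar R) (k : nat) : \bar R :=
  esum [set: int * int] (fun ab => (ent_term (fine (mu (dsq k ab))))%:E).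

(* Finitely supported measures  nu = sum_{u : U} wt u * delta_{pt u}    *)
Section Discrete.
Variables (U : finType) (wt : U -> R) (pt : U -> R * R).

Definition dmass (A : set (R * R)) : R := \sum_(v : U | `[< A (pt v) >]) wt v.

(* (nu_{x,i} * tau)(A), where nu_{x,i} = nu|_{D_i(x)} / nu(D_i(x)) is the raw
   component and * is convolution:  sum over atoms a of nu_{x,i}({a}) tau(A - a). *)
Definition comp_conv (x : R * R) (i : nat) (tau : set (R * R) -> \bar R)
    (A : set (R * R)) : \bar R :=
  (\sum_(v : U | `[< Dsq i x (pt v) >])
      (wt v / dmass (Dsq i x))%:E * tau [set z | A (cadd (pt v) z)])%E.

(* P_{i=n}(nu_{x,i} in Acomp) = nu({x : nu_{x,n} in Acomp}) ; the component
   nu_{x,n} is represented by the pair (x, n), and Acomp is a predicate on it. *)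
Definition Pcomp (n : nat) (Acomp : R * R -> nat -> Prop) : R :=
  \sum_(v : U | `[< Acomp (pt v) n >]) wt v.
End Discrete.
End Plane.

(* [i0] is only used to equip the type with a point (I is nonempty). *)
Definition seqI (I : finType) (i0 : I) := (nat -> I)%type.
HB.instance Definition _ (I : finType) (i0 : I) := Choice.on (@seqI I i0).
HB.instance Definition _ (I : finType) (i0 : I) :=
  isPointed.Build (@seqI I i0) (fun _ => i0).

Definition cylinders (I : finType) (i0 : I) : set (set (seqI i0)) :=
  [set A | exists (m : nat) (i : I), A = [set w : seqI i0 | w m = i]].

Definition Omega (I : finType) (i0 : I) := g_sigma_algebraType (@cylinders I i0).

Definition shift (I : finType) (i0 : I) (w : Omega i0) : Omega i0 :=
  fun m => w m.+1.

Section Selection.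
Variables (R : realType) (I : finType) (i0 : I).

Definition T_invariant (P : probability (Omega i0) R) : Prop :=
  forall A : set (Omega i0), measurable A -> P (@shift I i0 @^-1` A) = P A.

Definition ergodic (P : probability (Omega i0) R) : Prop :=
  forall A : set (Omega i0), measurable A -> @shift I i0 @^-1` A = A ->
    P A = 0%E \/ P A = 1%E.
End Selection.

Section Model.
Variables (R : realType) (I : finType) (i0 : I) (J : I -> finType).
Variables (p : forall i, J i -> R) (t : forall i, J i -> R * R)
          (r : I -> R) (phi : I -> R * R).

Definition lam (i : I) : R * R := cscale (r i) (phi i).

Definition fmp (i : I) (j : J i) (z : R * R) : R * R := cadd (cmul (lam i) z) (t j).

(* X^{(omega)}_n = prod_{j <= n} {1..k_{omega_j}}   (omega_1 is w 0) *)
Definition Xw (w : nat -> I) (n : nat) : finType := {dffun forall m : 'I_n, J (w m)}.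

Definition fw (w : nat -> I) (n : nat) (u : Xw w n) : R * R -> R * R :=
  \big[(fun f g => f \o g)/id]_(m < n) fmp (u m).

Definition pw (w : nat -> I) (n : nat) (u : Xw w n) : R :=
  \prod_(m < n) p (u m).

Definition Lam (w : nat -> I) (n : nat) : R * R :=
  \big[@cmul R/cone R]_(m < n) lam (w m).

(* eta is (the family of) laws of sum_n (prod_{j<n} lambda_{omega_j}) t_{u_n}.
   The partial sums have law nu^{(omega,n)}, and converge surely (uniformly);
   hence eta^{(omega)} is characterised as the weak limit of nu^{(omega,n)}. *)
Definition is_eta (eta : Omega i0 -> probability (R * R)%type R) : Prop :=
  forall (w : Omega i0) (f : R * R -> R), continuous f ->
    (exists M : R, forall z, `|f z| <= M) ->
    (fun n => (\sum_(u : Xw w n) pw u * f (fw u (czero R)))%:E) @ \oo -->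
      (\int[eta w]_z (f z)%:E)%E.

Definition tauw (eta : Omega i0 -> probability (R * R)%type R) (w : Omega i0) (n : nat)
    (A : set (R * R)) : \bar R :=
  eta (iter n (@shift I i0) w) [set z | A (cmul (Lam w n) z)].

Definition nprime (Rad : R) (w : Omega i0) (n : nat) : nat :=
  let P := fun m : nat => 2 * Rad * \prod_(j < m) r (w j) <= ((2:R) ^+ n)^-1 in
  match pselect (exists m, P m) with
  | left h => ex_minn h
  | right _ => 0%N
  end.

Definition Gset (eta : Omega i0 -> probability (R * R)%type R) (Rad : R)
    (eps delta : R) (q n : nat) : set (Omega i0) :=
  [set w | let n' := nprime Rad w n in
     let tau := tauw eta w n' in
     Pcomp (@pw w n') (fun u => fw u (czero R)) n
       (fun x i =>
          (((q * n)%:R)^-1)%:E *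
            `| entropy (comp_conv (@pw w n') (fun u => fw u (czero R)) x i tau)
                       ((q + 1) * n)
               - entropy tau ((q + 1) * n) |
          < delta%:E)%E
     > 1 - eps].
End Model.

(* Main.v *)
Require Import Defs.
From HB Require Import structures.
From mathcomp Require Import all_boot all_order all_algebra.
From mathcomp Require Import all_classical all_reals all_analysis.
From mathcomp Require Import measurable_realfun ring lra zify.
(* [cadd] and [cscale] also name operations on charges. *)
Import Defs.
Import Order.TTheory GRing.Theory Num.Theory.
Import numFieldNormedType.Exports.
Local Open Scope classical_set_scope.
Local Open Scope ring_scope.

Set Implicit Arguments.
Unset Strict Implicit.
Unset Printing Implicit Defensive.

(** The entropy [sigma_N(w)] of the law of [f_u(0)], [u] in [X_N], on the grid of
    side [r_{w_1} ... r_{w_N}] is superadditive along the shift up to a constant: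
    [sigma_n(w) + sigma_m(T^n w) <= sigma_{n+m}(w) + C].  By Fekete's lemma its
    mean is linear up to [o(N)], so the nonnegative defect of superadditivity has
    mean [o(s)] at times [a s <= b s], [b <= l], and by Markov's inequality all
    these defects are at most [s] with probability tending to one.  For such a
    [w], taking [s] a small multiple of [n] and comparing the dyadic scales [n]
    and [(q+1)n] with the nearest multiples of [s], one gets
    [H(eta, D_{(q+1)n}) - H(eta, D_n) - H(tau, D_{(q+1)n}) <= small * n].
    The left side dominates, up to [O(1)], the mean over components of
    [d(x) = H(nu_{x,n} * tau, D_{(q+1)n}) - H(tau, D_{(q+1)n})], while concavity of
    entropy gives [d(x) >= -O(1)] for every [x]; Markov's inequality in [x]
    concludes.  All entropies are computed on finite spaces of words: truncating
    [eta] at a scale below the grid changes an entropy by at most [ln 9]. *)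

(** * Shannon entropy on a finite weighted space *)

(** The obstacle is that [N = n'(omega)] depends on the sequence, so [T^N omega] need not have law
    [P] and invariance cannot be applied at time [N]. Control is therefore asked only at
    deterministic times, for all pairs of multiples of [s] at once, and [N] is rounded down to such
    a multiple afterwards. Rounding costs at most [s] letters, hence [O(s)] of entropy, which is why
    [s] must be a small fraction of [n]. Since [s] is about [n / B] with [B] fixed, the number of
    blocks needed to reach scale [(q+1)n] does not depend on [n], and a union bound suffices. The
    grid of side [r_{w_1} ... r_{w_N}] replaces a dyadic one because its scale factors exactly along
    the shift and is read off the first [N] letters. Word entropies use the natural logarithm; the
    factor [ln 2] enters when they meet [entropy]. *)

Section Shannon.
Variable R : realType.

Definition pweight (A : finType) (w : A -> R) :=
  (forall a, 0 <= w a) /\ \sum_a w a = 1.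

Definition prb (A : finType) (w : A -> R) (T : eqType) (f : A -> T) (y : T) : R :=
  \sum_(a | f a == y) w a.

(* Summing over the points of the space instead of over the values of [f]
   makes monotonicity in the partition a termwise comparison. *)
Definition shent (A : finType) (w : A -> R) (T : eqType) (f : A -> T) : R :=
  - \sum_a w a * ln (prb w f (f a)).

(** Extended by zero off the fibre, so that all components are weights on one and the same word
    space. For the cells of side [2^-n] it is the raw component, lifted to words. *)
Definition cond (A : finType) (w : A -> R) (T : eqType) (D : A -> T) (d : T)
  (a : A) : R := if D a == d then w a / prb w D d else 0.

Definition prodw (U V : finType) (c : U -> R) (q : V -> R) (a : U * V) : R :=
  c a.1 * q a.2.

Section Basic.
Variables (A : finType) (w : A -> R).
Hypothesis w0 : forall a, 0 <= w a.

Lemma prb_ge0 (T : eqType) (f : A -> T) y : 0 <= prb w f y.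
Proof. by apply: sumr_ge0. Qed.

Lemma prb_ge (T : eqType) (f : A -> T) a : w a <= prb w f (f a).
Proof. by rewrite /prb (bigD1 a)//= lerDl sumr_ge0. Qed.

Lemma prb_gt0 (T : eqType) (f : A -> T) a : 0 < w a -> 0 < prb w f (f a).
Proof. by move=> wa; apply: lt_le_trans (prb_ge f a). Qed.

Lemma le_prb (T T' : eqType) (f : A -> T) (g : A -> T') y z :
  (forall a, f a = y -> g a = z) -> prb w f y <= prb w g z.
Proof.
move=> fg; rewrite /prb big_mkcond [leRHS]big_mkcond /=.
apply: ler_sum => a _; case: (f a =P y) => [/fg ->|_]; first by rewrite eqxx.
by case: ifP.
Qed.

Hypothesis w1 : \sum_a w a = 1.

Lemma prb_le1 (T : eqType) (f : A -> T) y : prb w f y <= 1.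
Proof.
rewrite -w1 /prb big_mkcond /=; by apply: ler_sum => a _; case: ifP.
Qed.

Lemma ler_sum_weight (F G : A -> R) :
  (forall a, 0 < w a -> F a <= G a) -> \sum_a w a * F a <= \sum_a w a * G a.
Proof.
move=> FG; apply: ler_sum => a _.
have := w0 a; rewrite le_eqVlt => /predU1P[<-|wa]; first by rewrite !mul0r.
by rewrite ler_pM2l//; exact: FG.
Qed.

Lemma eq_sum_weight (F G : A -> R) :
  (forall a, 0 < w a -> F a = G a) -> \sum_a w a * F a = \sum_a w a * G a.
Proof.
move=> FG; apply/eqP; rewrite eq_le.
by apply/andP; split; apply: ler_sum_weight => a /FG ->.
Qed.

Lemma shent_ge0 (T : eqType) (f : A -> T) : 0 <= shent w f.
Proof.
rewrite /shent -sumrN; apply: sumr_ge0 => a _.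
by rewrite -mulrN mulr_ge0// oppr_ge0 ln_le0// prb_le1.
Qed.

Lemma le_shent (T T' : eqType) (f : A -> T) (g : A -> T') :
  (forall a b, g a = g b -> f a = f b) -> shent w f <= shent w g.
Proof.
move=> gf; rewrite /shent lerN2; apply: ler_sum_weight => a wa.
rewrite ler_ln ?posrE ?prb_gt0//; apply: le_prb => b; exact: gf.
Qed.

Lemma ln_le_subr1 (x : R) : 0 < x -> ln x <= x - 1.
Proof.
by move=> x0; have := @le_ln1Dx R (x - 1); rewrite [1 + _]addrC subrK; apply; lra.
Qed.

(* Gibbs' inequality against the reference measure [prb w f] times [w2], of
   total mass [c]: taking [w2] to be the law of [g], resp. the counting measure
   on the range of [g], gives subadditivity, resp. the bound by the logarithm
   of the number of values. *)
Lemma shent_gibbs (B : finType) (w2 : B -> R) (T T' : eqType)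
    (f : A -> T) (g : A -> T') (h : B -> T') (c : R) :
  (forall b, 0 <= w2 b) -> 0 < c -> \sum_b w2 b = c ->
  (forall a, 0 < w a -> 0 < prb w2 h (g a)) ->
  shent w (fun a => (f a, g a)) <=
    shent w f - \sum_a w a * ln (prb w2 h (g a)) + ln c.
Proof.
move=> w20 c0 w2c hpos.
set fg := fun a => (f a, g a).
have pfg a : 0 < w a -> 0 < prb w fg (f a, g a) by exact: (prb_gt0 fg).
pose y a := prb w f (f a) * prb w2 h (g a) / prb w fg (f a, g a).
(* [y] is a likelihood ratio. Expanding both marginals turns its mean into the reference mass of
   those cells [(f b, h b')] that the pair [(f, g)] charges, hence at most [1 * c]. *)
have sumy : \sum_a w a * y a <= c.
  rewrite /y.
  have -> : \sum_a w a * (prb w f (f a) * prb w2 h (g a) / prb w fg (f a, g a)) =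
      \sum_b \sum_b' w b * w2 b' *
        \sum_(a | (f a == f b) && (g a == h b')) w a / prb w fg (f b, h b').
    have E a : w a * (prb w f (f a) * prb w2 h (g a) / prb w fg (f a, g a)) =
        \sum_b \sum_b' if (f a == f b) && (g a == h b')
         then w b * w2 b' * (w a / prb w fg (f a, g a)) else 0.
      rewrite [X in X * prb w2 _ _]/prb [X in _ * X / _]/prb.
      rewrite !mulr_suml mulr_sumr big_mkcond; apply: eq_bigr => b _.
      rewrite [f b == f a]eq_sym; case: ifP => fab; last by rewrite big1.
      rewrite mulr_sumr mulr_suml mulr_sumr big_mkcond; apply: eq_bigr => b' _.
      by rewrite [h b' == g a]eq_sym; case: ifP => //= _; ring.
    rewrite (eq_bigr _ (fun a _ => E a)).
    rewrite exchange_big; apply: eq_bigr => b _.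
    rewrite exchange_big; apply: eq_bigr => b' _.
    rewrite mulr_sumr -big_mkcond /=; apply: eq_bigr => a /andP[/eqP-> /eqP->].
    by [].
  apply: (@le_trans _ _ (\sum_b \sum_b' w b * w2 b')).
    apply: ler_sum => b _; apply: ler_sum => b' _.
    rewrite ler_piMr ?mulr_ge0// -mulr_suml.
    have -> : \sum_(i | (f i == f b) && (g i == h b')) w i = prb w fg (f b, h b').
      by apply: eq_bigl => i; rewrite /fg xpair_eqE.
    case: (eqVneq (prb w fg (f b, h b')) 0) => [->|nz]; first by rewrite mul0r.
    by rewrite divff.
  under eq_bigr do rewrite -mulr_sumr.
  by rewrite -mulr_suml w1 mul1r w2c.
have : \sum_a w a * (ln (y a) - ln c) <= \sum_a w a * (y a / c - 1).
  apply: ler_sum_weight => a wa.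
  have ya : 0 < y a by rewrite /y divr_gt0 ?mulr_gt0 ?prb_gt0 ?hpos ?pfg.
  by rewrite -ln_div ?posrE//; apply: ln_le_subr1; rewrite divr_gt0.
have -> : \sum_a w a * (y a / c - 1) = (\sum_a w a * y a) / c - 1.
  rewrite -[X in _ = _ - X]w1 mulr_suml -sumrB; apply: eq_bigr => a _; ring.
have -> : \sum_a w a * (ln (y a) - ln c) =
   shent w fg - shent w f + \sum_a w a * ln (prb w2 h (g a)) - ln c.
  rewrite /shent -[X in _ = _ - X]mul1r -w1 mulr_suml opprK -!sumrN -!big_split /=.
  rewrite (eq_sum_weight (G := fun a => - ln (prb w fg (f a, g a)) +
    ln (prb w f (f a)) + ln (prb w2 h (g a)) - ln c)); last first.
    move=> a wa; rewrite /y ln_div ?posrE ?mulr_gt0 ?prb_gt0 ?hpos ?pfg//.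
    rewrite lnM ?posrE ?prb_gt0 ?hpos//; ring.
  by apply: eq_bigr => a _; ring.
have : (\sum_a w a * y a) / c <= 1 by rewrite ler_pdivrMr// mul1r.
lra.
Qed.

Lemma shent_pairD (T T' : eqType) (f : A -> T) (g : A -> T') :
  shent w (fun a => (f a, g a)) <= shent w f + shent w g.
Proof.
have := shent_gibbs (w2 := w) f (g := g) (h := g) (c := 1) w0 ltr01 w1.
by rewrite ln1 addr0; apply => a wa; exact: prb_gt0.
Qed.

Lemma shent_pair_fin (K : finType) (T : eqType) (f : A -> T) (k : A -> K) :
  shent w (fun a => (f a, k a)) <= shent w f + ln #|K|%:R.
Proof.
have [a _] : exists a : A, true.
  apply/existsP; apply: contraT; rewrite negb_exists => /forallP A0.
  by move: w1; rewrite big1 => [|a]; [move/eqP; rewrite eq_sym oner_eq0|have := A0 a].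
have K0 : 0 < #|K|%:R :> R by rewrite ltr0n; apply/card_gt0P; exists (k a).
have one b : prb (fun _ : K => 1) id b = 1 :> R by rewrite /prb big_pred1_eq.
have := shent_gibbs (w2 := fun _ : K => 1) f (g := k) (h := id) _ K0.
rewrite [X in _ <= _ - X + _]big1 ?subr0 => [|b _]; last by rewrite one ln1 mulr0.
apply => // [|b _]; last by rewrite one.
by rewrite sumr_const.
Qed.

Lemma shent_fin (K : finType) (k : A -> K) : shent w k <= ln #|K|%:R.
Proof.
have := shent_pair_fin (fun=> tt) k.
have -> : shent w (fun _ : A => tt) = 0.
  rewrite /shent big1 ?oppr0// => a _.
  by rewrite /prb (eq_bigl predT) ?w1 ?ln1 ?mulr0// => b; rewrite eqxx.
rewrite add0r; apply: le_trans; apply: le_shent => a b [] //.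
Qed.

Lemma pweight_cond (T : eqType) (D : A -> T) a :
  0 < w a -> pweight (cond w D (D a)).
Proof.
move=> wa; split=> [b|].
  by rewrite /cond; case: ifP => // _; rewrite divr_ge0 ?prb_ge0.
rewrite /cond -big_mkcond/= -mulr_suml divff// gt_eqF//; exact: prb_gt0.
Qed.

(** Chain rule. The outer average runs over points, so a fibre of [D] is met with weight
    [prb w D d], which cancels the normalisation in [cond]. *)
Lemma shent_chain (T T' : eqType) (D : A -> T) (Y : A -> T') :
  \sum_a w a * shent (cond w D (D a)) Y = shent w (fun a => (D a, Y a)) - shent w D.
Proof.
pose P2 a := prb w (fun a => (D a, Y a)) (D a, Y a).
pose L b := ln (prb w D (D b)) - ln (P2 b).
have condE a : 0 < w a -> shent (cond w D (D a)) Y =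
    \sum_b if D b == D a then w b / prb w D (D a) * L b else 0.
  move=> wa; rewrite /shent -sumrN; apply: eq_bigr => b _.
  rewrite {1}/cond; case: eqP => [Dba|]; last by rewrite mul0r oppr0.
  have := w0 b; rewrite le_eqVlt => /predU1P[<-|wb]; first by rewrite !mul0r oppr0.
  have -> : prb (cond w D (D a)) Y (Y b) = P2 b / prb w D (D b).
    rewrite /prb /cond /P2 -Dba -big_mkcondr/= -mulr_suml; congr (_ / _).
    by apply: eq_bigl => i; rewrite xpair_eqE andbC.
  rewrite -mulrN /L ln_div ?opprB// posrE; first exact: (prb_gt0 (fun a => (D a, Y a))).
  exact: prb_gt0.
rewrite (eq_sum_weight condE).
under eq_bigr do rewrite mulr_sumr.
rewrite exchange_big /=.
have -> : shent w (fun a => (D a, Y a)) - shent w D = \sum_b w b * L b.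
  by rewrite /shent opprK addrC -sumrB; apply: eq_bigr => b _; rewrite -mulrBr.
apply: eq_bigr => b _.
rewrite (eq_bigr (fun a => if D a == D b then w a * (w b / prb w D (D b) * L b) else 0)).
  rewrite -big_mkcond /= -mulr_suml -/(prb w D (D b)).
  have := w0 b; rewrite le_eqVlt => /predU1P[<-|wb]; first by rewrite !mul0r mulr0.
  by rewrite mulrA mulrCA divff ?mulr1// gt_eqF// prb_gt0.
by move=> a _; rewrite eq_sym; case: eqP => [->//|_]; rewrite mulr0.
Qed.

End Basic.

(** Equality of laws is asked in integrated form because sums over words rearrange as integrals;
    indicators then recover the masses. *)
Lemma shent_law (A B : finType) (w : A -> R) (w' : B -> R) (T : eqType)
    (f : A -> T) (g : B -> T) :
  (forall F : T -> R, \sum_a w a * F (f a) = \sum_b w' b * F (g b)) ->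
  shent w f = shent w' g.
Proof.
move=> fg; rewrite /shent (fg (fun y => ln (prb w f y))); congr (- _).
apply: eq_bigr => b _; congr (_ * ln _).
have prbE (C : finType) (v : C -> R) (h : C -> T) y :
    prb v h y = \sum_c v c * (h c == y)%:R.
  by rewrite /prb big_mkcond; apply: eq_bigr => c _; case: eqP; rewrite (mulr1, mulr0).
by rewrite !prbE; exact: (fg (fun y => (y == g b)%:R)).
Qed.

(** * Independent pairs and conditioning on the first factor *)

Section Product.
Variables (U V : finType) (c : U -> R) (q : V -> R).
Hypotheses (cw : pweight c) (qw : pweight q).

Lemma pweight_prod : pweight (prodw c q).
Proof.
case: cw qw => [c0 c1] [q0 q1]; split=> [a|]; first exact: mulr_ge0.
rewrite -(pair_bigA _ (fun u v => c u * q v))/=.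
by under eq_bigr do rewrite -mulr_sumr q1 mulr1.
Qed.

Lemma sum_prodw (F : U -> V -> R) :
  \sum_a prodw c q a * F a.1 a.2 = \sum_u c u * \sum_v q v * F u v.
Proof.
rewrite -(pair_bigA _ (fun u v => c u * q v * F u v))/=; apply: eq_bigr => u _.
by rewrite mulr_sumr; apply: eq_bigr => v _; rewrite mulrA.
Qed.

Lemma shent_prod1 (T : eqType) (f : U -> T) :
  shent (prodw c q) (fun a => f a.1) = shent c f.
Proof.
apply: shent_law => F; rewrite (sum_prodw (fun u v => F (f u))).
by apply: eq_bigr => u _; rewrite -mulr_suml (proj2 qw) mul1r.
Qed.

Lemma shent_prod2 (T : eqType) (f : V -> T) :
  shent (prodw c q) (fun a => f a.2) = shent q f.
Proof.
apply: shent_law => F; rewrite (sum_prodw (fun u v => F (f v))).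
by rewrite -mulr_suml (proj2 cw) mul1r.
Qed.

Lemma prb_prod1 (T : eqType) (f : U -> T) y :
  prb (prodw c q) (fun a => f a.1) y = prb c f y.
Proof.
rewrite /prb (eq_bigl (fun b => (f b.1 == y) && predT b.2)) => [|b]; last first.
  by rewrite andbT.
rewrite -(pair_big (fun u => f u == y) predT (fun u v => c u * q v))/=.
by under eq_bigr do rewrite -mulr_sumr (proj2 qw) mulr1.
Qed.

(** Conditioning on the first factor leaves the second one independent, so the chain rule turns a
    mean over components of entropies of convolutions into a difference of two entropies. *)
Lemma shent_mean_cond (T T' : eqType) (D : U -> T) (Y : U * V -> T') :
  \sum_u c u * shent (prodw (cond c D (D u)) q) Y =
  shent (prodw c q) (fun a => (D a.1, Y a)) - shent c D.
Proof.
have [w0 w1] := pweight_prod.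
rewrite -shent_prod1 -(shent_chain w0) /=.
have condE u : cond (prodw c q) (fun a => D a.1) (D u) = prodw (cond c D (D u)) q.
  apply/funext => a; rewrite /cond /prodw prb_prod1; case: ifP => _; last by rewrite mul0r.
  by rewrite mulrAC.
under [RHS]eq_bigr do rewrite condE.
rewrite (sum_prodw (fun u v => shent (prodw (cond c D (D u)) q) Y)).
by apply: eq_bigr => u _; rewrite -mulr_suml (proj2 qw) mul1r.
Qed.

Lemma shent_indep (T T' : eqType) (f : U -> T) (g : V -> T') :
  shent (prodw c q) (fun a => (f a.1, g a.2)) = shent c f + shent q g.
Proof.
case: cw qw (pweight_prod) => [c0 c1] [q0 q1] [w0 w1].
rewrite -shent_prod1 -shent_prod2 /shent -opprD -big_split /=; congr (- _).
under [RHS]eq_bigr do rewrite -mulrDr.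
apply: eq_sum_weight => // a wa.
rewrite -lnM ?posrE; [|exact: (prb_gt0 w0 (fun a => f a.1))|exact: (prb_gt0 w0 (fun a => g a.2))].
congr ln.
have E2 : prb (prodw c q) (fun a => g a.2) (g a.2) = prb q g (g a.2).
  rewrite /prb -(pair_big predT (fun v => g v == g a.2) (fun u v => c u * q v))/=.
  by under eq_bigr do rewrite -mulr_sumr; rewrite -mulr_suml c1 mul1r.
rewrite (prb_prod1 f) E2 /prb (eq_bigl (fun b => (f b.1 == f a.1) && (g b.2 == g a.2))); last first.
  by move=> b; rewrite xpair_eqE.
rewrite -(pair_big (fun u => f u == f a.1) (fun v => g v == g a.2) (fun u v => c u * q v))/=.
by under eq_bigr do rewrite -mulr_sumr; rewrite -mulr_suml.
Qed.

End Product.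

End Shannon.

(** * Grids in the plane *)

Section Grid.
Variable R : realType.
Implicit Types (z : R * R) (k : R).

Definition cell k z : int * int := (Num.floor (k * z.1), Num.floor (k * z.2)).

(* Logarithm of the number of offsets in {-c, ..., c}^2. *)
Definition lnbox (c : nat) : R := ln ((c.*2.+1 ^ 2)%:R).

Lemma lnbox_ge0 c : 0 <= lnbox c.
Proof. by apply: ln_ge0; rewrite ler1n expn_gt0. Qed.

Lemma floor_dist (x y : R) (c : nat) :
  `|x - y| <= c%:R -> (`|Num.floor x - Num.floor y| <= c%:Z)%R.
Proof.
have half (a b : R) : a - b <= c%:R -> (Num.floor a <= Num.floor b + c%:Z)%R.
  move=> ab; suff : (Num.floor a < Num.floor b + c%:Z + 1)%R by lia.
  rewrite floor_lt_int !intrD.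
  by have /andP[_] := floor_itv b; rewrite intrD; lra.
move=> xy; have /half : x - y <= c%:R by apply: le_trans (ler_norm _) xy.
have /half : y - x <= c%:R by rewrite distrC in xy; apply: le_trans (ler_norm _) xy.
lia.
Qed.

Lemma floor_eq_dist (x y : R) : Num.floor x = Num.floor y -> `|x - y| <= 1.
Proof.
move=> xy; have := floor_itv x; have := floor_itv y; rewrite xy !intrD ler_norml; lra.
Qed.

Lemma cell_eq k z z' : cell k z = cell k z' ->
  `|k * z.1 - k * z'.1| <= 1 /\ `|k * z.2 - k * z'.2| <= 1.
Proof. by case=> /floor_eq_dist ? /floor_eq_dist ?. Qed.

(** Inside a fibre of [f] the cell is determined by its offset from the cell of one reference point,
    and only [(2c+1)^2] offsets occur. *)
Lemma shent_cell (A : finType) (w : A -> R) (T : eqType) (f : A -> T)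
    (Y : A -> R * R) k (c : nat) : pweight w ->
  (forall a b, f a = f b ->
    `|k * (Y a).1 - k * (Y b).1| <= c%:R /\ `|k * (Y a).2 - k * (Y b).2| <= c%:R) ->
  shent w (fun a => (f a, cell k (Y a))) <= shent w f + lnbox c.
Proof.
move=> [w0 w1] close.
(* The default is never reached, as [a] lies in its own fibre; hence [ref] is constant on fibres. *)
pose ref a := odflt a [pick b | f b == f a].
have fref a : f (ref a) = f a by rewrite /ref; case: pickP => [b /eqP|].
have refE a b : f a = f b -> ref a = ref b.
  by move=> fab; rewrite /ref fab; case: pickP => // /(_ b); rewrite eqxx.
(* Adding [c] makes the offset nonnegative, and [floor_dist] keeps it below [2c+1], so [inord] loses
   nothing. *)
pose off (x y : R) : 'I_(c.*2.+1) := inord `|(Num.floor x - Num.floor y + c%:Z)%R|%N.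
have off_inj x x' y : `|x - y| <= c%:R -> `|x' - y| <= c%:R ->
    off x y = off x' y -> Num.floor x = Num.floor x'.
  move=> /floor_dist xy /floor_dist x'y /(congr1 val).
  rewrite /off /= !inordK; lia.
pose g a := (off (k * (Y a).1) (k * (Y (ref a)).1), off (k * (Y a).2) (k * (Y (ref a)).2)).
have -> : lnbox c = ln #|{: 'I_(c.*2.+1) * 'I_(c.*2.+1)}|%:R.
  by rewrite card_prod !card_ord.
apply: le_trans (shent_pair_fin w0 w1 f g).
apply: le_shent => // a b [fab].
rewrite (refE _ _ fab) => g1 g2; rewrite /cell fab.
have [a1 a2] : `|k * (Y a).1 - k * (Y (ref b)).1| <= c%:R /\
    `|k * (Y a).2 - k * (Y (ref b)).2| <= c%:R by apply: close; rewrite fref.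
have [b1 b2] := close b (ref b) (esym (fref b)).
by rewrite (off_inj _ _ _ a1 b1 g1) (off_inj _ _ _ a2 b2 g2).
Qed.

Lemma shent_cell_le (A : finType) (w : A -> R) (T : eqType) (f : A -> T)
    (Y : A -> R * R) k (c : nat) : pweight w ->
  (forall a b, f a = f b ->
    `|k * (Y a).1 - k * (Y b).1| <= c%:R /\ `|k * (Y a).2 - k * (Y b).2| <= c%:R) ->
  shent w (fun a => cell k (Y a)) <= shent w f + lnbox c.
Proof.
move=> wP close; apply: le_trans (shent_cell wP close).
by case: wP => w0 w1; apply: le_shent => // a b [_ e1 e2]; rewrite /cell e1 e2.
Qed.

Lemma cnormM z z' : cnorm (cmul z z') = cnorm z * cnorm z'.
Proof.
rewrite /cnorm -sqrtrM ?addr_ge0 ?sqr_ge0//; congr Num.sqrt; rewrite /cmul /=; ring.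
Qed.

Lemma cnorm_scale (a : R) z : 0 <= a -> cnorm (cscale a z) = a * cnorm z.
Proof.
move=> a0; rewrite /cnorm /cscale /= !exprMn -mulrDr sqrtrM ?sqr_ge0//.
by rewrite sqrtr_sqr ger0_norm.
Qed.

Lemma ler_cnorm1 z : `|z.1| <= cnorm z.
Proof. by rewrite -sqrtr_sqr ler_wsqrtr// lerDl sqr_ge0. Qed.

Lemma ler_cnorm2 z : `|z.2| <= cnorm z.
Proof. by rewrite -sqrtr_sqr ler_wsqrtr// lerDr sqr_ge0. Qed.

Lemma cnorm_le z : cnorm z <= `|z.1| + `|z.2|.
Proof.
rewrite -[leRHS]ger0_norm ?addr_ge0// -sqrtr_sqr ler_wsqrtr//.
rewrite -(real_normK (num_real z.1)) -(real_normK (num_real z.2)).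
have := mulr_ge0 (normr_ge0 z.1) (normr_ge0 z.2); nra.
Qed.

Lemma cmulBr L z z' : cmul L (z - z') = cmul L z - cmul L z'.
Proof. by rewrite /cmul /=; congr pair; rewrite /=; ring. Qed.

Lemma cmulA (x y z : R * R) : cmul x (cmul y z) = cmul (cmul x y) z.
Proof. by rewrite /cmul /=; congr pair; ring. Qed.

Lemma cmul_addr L z z' : cmul L (cadd z z') = cadd (cmul L z) (cmul L z').
Proof. by rewrite /cmul /cadd /=; congr pair; ring. Qed.

Lemma caddA (x y z : R * R) : cadd x (cadd y z) = cadd (cadd x y) z.
Proof. by rewrite /cadd /= !addrA. Qed.

Lemma caddC (x y : R * R) : cadd x y = cadd y x.
Proof. by rewrite /cadd /= addrC [_.2 + _]addrC. Qed.

(** Adding an independent variable cannot lower entropy by more than a constant. Given [X], the cell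
    of [X + Z] fixes that of [Z] up to a neighbour; independence makes the joint entropy
    [H(X) + H(cell Z)], and [H(X)] cancels. *)
Lemma conv_lower (U V : finType) (c : U -> R) (q : V -> R) (X : U -> R * R)
    (Z : V -> R * R) k : pweight c -> pweight q ->
  shent q (fun v => cell k (Z v)) <=
    shent (prodw c q) (fun a => cell k (cadd (X a.1) (Z a.2))) + lnbox 1.
Proof.
move=> cP qP; have wP := pweight_prod cP qP; have [w0 w1] := wP.
set Y := fun a : U * V => cell k (cadd (X a.1) (Z a.2)).
have H1 := shent_pairD w0 w1 Y (fun a => a.1).
have H2 : shent (prodw c q) (fun a => ((Y a, a.1), cell k (Z a.2))) <=
    shent (prodw c q) (fun a => (Y a, a.1)) + lnbox 1.
  apply: shent_cell => // a b ab; have ab1 : a.1 = b.1 by case: ab.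
  have [] : `|k * (cadd (X a.1) (Z a.2)).1 - k * (cadd (X b.1) (Z b.2)).1| <= 1 /\
     `|k * (cadd (X a.1) (Z a.2)).2 - k * (cadd (X b.1) (Z b.2)).2| <= 1.
    by apply: cell_eq; case: ab => e1 e2 _; rewrite /cell e1 e2.
  have D (x y z : R) : k * (x + y) - k * (x + z) = k * y - k * z by ring.
  by rewrite ab1 /cadd /= !D.
have H3 : shent (prodw c q) (fun a => (a.1, cell k (Z a.2))) <=
    shent (prodw c q) (fun a => ((Y a, a.1), cell k (Z a.2))).
  by apply: le_shent => // a b [_ _ -> e1 e2]; rewrite /cell e1 e2.
have H4 := shent_indep cP qP id (fun v => cell k (Z v)).
have H5 := shent_prod1 c qP id.
lra.
Qed.

Lemma close_translate (k1 k x x' z z' e B : R) : 0 < k1 -> k1 <= k ->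
  `|k * (x + z) - k * (x' + z')| <= 1 -> `|z| <= e -> `|z'| <= e -> k1 * e <= B ->
  `|k1 * x - k1 * x'| <= 1 + B *+ 2.
Proof.
move=> k10 k1k H ze z'e eB.
have H1 : k1 * `|x + z - (x' + z')| <= 1.
  apply: le_trans H; rewrite -mulrBr normrM ler_wpM2r// (le_trans k1k)//; exact: ler_norm.
have -> : k1 * x - k1 * x' = k1 * (x + z - (x' + z')) - k1 * z + k1 * z' by ring.
apply: le_trans (ler_normD _ _) _; rewrite mulr2n addrA; apply: lerD; last first.
  by rewrite normrM gtr0_norm// (le_trans _ eB)// ler_pM2l.
apply: le_trans (ler_normB _ _) _; apply: lerD; first by rewrite normrM gtr0_norm.
by rewrite normrM gtr0_norm// (le_trans _ eB)// ler_pM2l.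
Qed.

(** Multiplication by [L] scales all distances by [cnorm L], so it can be undone without distortion.
    The factor 2 bounds the norm by the sum of the two coordinates. *)
Lemma close_cmul (L z z' : R * R) (k k1 c : R) : 0 < k -> 0 <= k1 -> 0 < cnorm L ->
  cell k (cmul L z) = cell k (cmul L z') -> 2 * k1 <= c * (k * cnorm L) ->
  k1 * cnorm (z - z') <= c.
Proof.
move=> k0 k10 L0 /cell_eq[H1 H2] kc.
have kL : 0 < k * cnorm L by rewrite mulr_gt0.
have H : k * cnorm L * cnorm (z - z') <= 2.
  rewrite -mulrA -cnormM cmulBr.
  have := cnorm_le (cmul L z - cmul L z'); rewrite -(ler_pM2l k0) mulrDr => /le_trans; apply.
  have e (x : R) : k * `|x| = `|k * x| by rewrite normrM gtr0_norm.
  rewrite !e [X in `|X| + _]mulrBr [X in _ + `|X|]mulrBr.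
  by apply: le_trans (lerD H1 H2) _; lra.
rewrite -(ler_pM2r kL); apply: le_trans (_ : k1 * 2 <= _); last by rewrite mulrC.
by rewrite -mulrA [cnorm _ * _]mulrC ler_wpM2l.
Qed.

End Grid.

(** * Finite words of the model *)

Section Words.
Variables (R : realType) (I : finType) (i0 : I) (J : I -> finType).
Variables (p : forall i, J i -> R) (t : forall i, J i -> R * R)
          (r : I -> R) (phi : I -> R * R).

Local Notation T := (@shift I i0).
Local Notation fw := (fw t r phi).
Local Notation pw := (pw p).
Local Notation fmp := (fmp t r phi).
Local Notation Lam := (Lam r phi).

Definition rho (w : nat -> I) (n : nat) : R := \prod_(m < n) r (w m).

(** The integrand sees the composed map and not the word: types of words depend on [w] and [n] and
    do not split or shift definitionally, whereas maps do compose. *)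
Definition Eg (w : Omega i0) n (G : (R * R -> R * R) -> R) : R :=
  \sum_(u : Xw J w n) pw u * G (fw u).

Lemma Eg0 (w : Omega i0) G : Eg w 0 G = G id.
Proof.
have u0 : Xw J w 0 by apply: finfun => -[].
rewrite /Eg (big_pred1 u0); first by rewrite /pw /fw !big_ord0 mul1r.
by move=> u; apply/esym/eqP/ffunP => -[].
Qed.

Definition word_cons (w : Omega i0) n (j : J (w 0)) (v : Xw J (T w) n)
    (m : 'I_n.+1) : J (w m) :=
  match m with
  | Ordinal 0 _ => j
  | Ordinal k.+1 lt => v (Ordinal (lt : (k < n)%N))
  end.

Lemma EgS (w : Omega i0) n G :
  Eg w n.+1 G = \sum_(j : J (w 0)) p j * Eg (T w) n (fun f => G (fmp j \o f)).
Proof.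
rewrite /Eg.
pose h (a : J (w 0) * Xw J (T w) n) : Xw J w n.+1 := [ffun m => word_cons a.1 a.2 m].
pose g (u : Xw J w n.+1) : J (w 0) * Xw J (T w) n :=
  (u ord0, [ffun m : 'I_n => u (lift ord0 m)]).
have irrv (v : Xw J (T w) n) k (l1 l2 : (k < n)%N) : v (Ordinal l1) = v (Ordinal l2).
  by rewrite (bool_irrelevance l1 l2).
have irru (u : Xw J w n.+1) k (l1 l2 : (k < n.+1)%N) : u (Ordinal l1) = u (Ordinal l2).
  by rewrite (bool_irrelevance l1 l2).
rewrite (reindex h); last first.
  exists g => [[j v] _|u _]; rewrite /h /g /=.
    congr pair; first by rewrite ffunE.
    apply/ffunP => m; rewrite !ffunE /=.
    by case: m => k lt /=; exact: irrv.
  apply/ffunP => -[[|k] lt]; rewrite !ffunE /=.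
    by rewrite (bool_irrelevance lt (ltn0Sn n)).
  rewrite ffunE /=.
  exact: irru.
rewrite -(pair_bigA _ (fun j v => pw (h (j, v)) * G (fw (h (j, v))))) /=.
apply: eq_bigr => j _; rewrite mulr_sumr; apply: eq_bigr => v _.
have hlift m : h (j, v) (lift ord0 m) = v m.
  by rewrite ffunE; case: m => k lt /=; exact: irrv.
rewrite mulrA; congr (_ * G _).
  rewrite /pw big_ord_recl ffunE /=; congr (_ * _).
  by apply: eq_bigr => m _; rewrite hlift.
rewrite /fw big_ord_recl ffunE /=; congr (_ \o _).
by apply: eq_bigr => m _; rewrite hlift.
Qed.

Lemma Eg_add (w : Omega i0) n m G :
  Eg w (n + m) G = Eg w n (fun f => Eg (iter n T w) m (fun g => G (f \o g))).
Proof.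
elim: n w G => [|n IH] w G; first by rewrite Eg0.
rewrite addSn !EgS; apply: eq_bigr => j _; congr (_ * _).
by rewrite IH iterSr.
Qed.

Lemma Eg_prefix (w w' : Omega i0) n G :
  (forall i, (i < n)%N -> w i = w' i) -> Eg w n G = Eg w' n G.
Proof.
elim: n w w' G => [|n IH] w w' G ww'; first by rewrite !Eg0.
rewrite !EgS -(ww' 0%N)//; apply: eq_bigr => j _; congr (_ * _).
by apply: IH => i ilt; exact: (ww' i.+1).
Qed.

Lemma Lam_prefix (w w' : Omega i0) n :
  (forall i, (i < n)%N -> w i = w' i) -> Lam w n = Lam w' n.
Proof. by move=> ww'; apply: eq_bigr => m _; rewrite ww'. Qed.

Lemma rho_prefix (w w' : Omega i0) n :
  (forall i, (i < n)%N -> w i = w' i) -> rho w n = rho w' n.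
Proof. by move=> ww'; apply: eq_bigr => m _; rewrite ww'. Qed.

Lemma iter_shift (w : Omega i0) n m : iter n T w m = w (n + m)%N.
Proof. by elim: n m => //= n IH m; rewrite /shift IH addnS. Qed.

Lemma rho_add (w : Omega i0) n m : rho w (n + m) = rho w n * rho (iter n T w) m.
Proof.
rewrite /rho big_split_ord /=; congr (_ * _).
by apply: eq_bigr => i _; rewrite iter_shift.
Qed.

Hypothesis p0 : forall i (j : J i), 0 < p j.
Hypothesis p1 : forall i, \sum_(j : J i) p j = 1.

Lemma pweight_pw (w : Omega i0) n : pweight (@pw w n).
Proof.
split=> [u|]; first by apply: prodr_ge0 => m _; exact: ltW.
have -> : \sum_(u : Xw J w n) pw u = Eg w n (fun=> 1).
  by apply: eq_bigr => u _; rewrite mulr1.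
elim: n w => [|n IH] w; first by rewrite Eg0.
rewrite EgS -[RHS](p1 (w 0%N)); apply: eq_bigr => j _.
by rewrite [X in _ * X](IH (T w)) mulr1.
Qed.

Lemma fw_affine (w : nat -> I) n (u : Xw J w n) z :
  fw u z = cadd (fw u (czero R)) (cmul (Lam w n) z).
Proof.
rewrite /fw /Lam.
have gen k (a b : 'I_k -> R * R) : forall z,
  (\big[(fun f g => f \o g)/id]_(m < k) (fun z => cadd (cmul (a m) z) (b m))) z =
  cadd ((\big[(fun f g => f \o g)/id]_(m < k) (fun z => cadd (cmul (a m) z) (b m)))
    (czero R)) (cmul (\big[@cmul R/cone R]_(m < k) a m) z).
  elim: k a b => [|k IH] a b {}z.
    rewrite !big_ord0 /cadd /cmul /cone /czero /= [LHS]surjective_pairing.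
    by congr pair; ring.
  rewrite !big_ord_recl /= IH cmul_addr -cmulA -!caddA; congr cadd; exact: caddC.
exact: gen.
Qed.

Variable Rad : R.
Hypothesis Rad0 : 0 < Rad.
Hypothesis r01 : forall i, 0 < r i < 1.
Hypothesis phi1 : forall i, cnorm (phi i) = 1.
Hypothesis fball : forall i (j : J i) z, cnorm z < Rad -> cnorm (fmp j z) < Rad.

Lemma rho_gt0 (w : nat -> I) n : 0 < rho w n.
Proof. by apply: prodr_gt0 => m _; case/andP: (r01 (w m)). Qed.

Lemma fw_ball (w : nat -> I) n (u : Xw J w n) : cnorm (fw u (czero R)) < Rad.
Proof.
have z0 : cnorm (czero R) < Rad by rewrite /cnorm /czero /= expr0n addr0 sqrtr0.
apply: (big_rec (fun f : R * R -> R * R => cnorm (f (czero R)) < Rad) z0).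
by move=> m f _ fz; exact: fball.
Qed.

Lemma cnorm_Lam (w : nat -> I) n : cnorm (Lam w n) = rho w n.
Proof.
rewrite /Lam /rho; elim/big_rec2: _ => [|m x y _ <-].
  by rewrite /cnorm /cone /= expr0n expr1n addr0 sqrtr1.
by rewrite cnormM cnorm_scale ?phi1 ?mulr1// ltW//; case/andP: (r01 (w m)).
Qed.

Lemma Lam_fw_le (w : nat -> I) n (w' : nat -> I) m (v : Xw J w' m) :
  let z := cmul (Lam w n) (fw v (czero R)) in
  `|z.1| <= rho w n * Rad /\ `|z.2| <= rho w n * Rad.
Proof.
move=> z; have zn : cnorm z <= rho w n * Rad.
  by rewrite cnormM cnorm_Lam ler_pM2l ?rho_gt0// ltW// fw_ball.
by split; apply: le_trans zn; [exact: ler_cnorm1|exact: ler_cnorm2].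
Qed.

(** * Entropies of word points at varying scales, and superadditivity *)

Definition HW (w : Omega i0) n (k : R) : R :=
  shent (@pw w n) (fun u => cell k (fw u (czero R))).

(* Entropy of [Lam_n f_v(0)], the finite stand-in for [tau^(omega,n)]. *)
Definition Zent (w : Omega i0) n m (k : R) : R :=
  shent (@pw (iter n T w) m) (fun v => cell k (cmul (Lam w n) (fw v (czero R)))).

Definition sigma (w : Omega i0) n : R := HW w n (rho w n)^-1.

Lemma HW_prefix (w w' : Omega i0) n k :
  (forall i, (i < n)%N -> w i = w' i) -> HW w n k = HW w' n k.
Proof.
move=> ww'; apply: shent_law => F.
exact: (Eg_prefix (fun f => F (cell k (f (czero R)))) ww').
Qed.

Lemma sigma_prefix (w w' : Omega i0) n :
  (forall i, (i < n)%N -> w i = w' i) -> sigma w n = sigma w' n.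
Proof. by move=> ww'; rewrite /sigma (rho_prefix ww'); exact: HW_prefix. Qed.

Lemma HW_split (w : Omega i0) n m k : HW w (n + m) k =
  shent (prodw (@pw w n) (@pw (iter n T w) m))
    (fun a => cell k (fw a.1 (fw a.2 (czero R)))).
Proof.
apply: shent_law => F.
rewrite (sum_prodw _ _ (fun u v => F (cell k (fw u (fw v (czero R)))))).
exact: (Eg_add w n m (fun f => F (cell k (f (czero R))))).
Qed.

Lemma HW_fst (w : Omega i0) n m k : HW w n k =
  shent (prodw (@pw w n) (@pw (iter n T w) m)) (fun a => cell k (fw a.1 (czero R))).
Proof.
by rewrite (shent_prod1 _ (pweight_pw _ _) (fun u => cell k (fw u (czero R)))).
Qed.

(** The coarse cell of the prefix point is almost free once the fine cell of the full point is
    known: the two points differ by at most [rho w n * Rad] in each coordinate, so two prefix points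
    are within [1 + 2B] coarse units. *)
Lemma pair_upper (w : Omega i0) n m k1 k (B : nat) :
  0 < k1 -> k1 <= k -> k1 * (rho w n * Rad) <= B%:R ->
  shent (prodw (@pw w n) (@pw (iter n T w) m))
    (fun a => (cell k1 (fw a.1 (czero R)), cell k (fw a.1 (fw a.2 (czero R))))) <=
  HW w (n + m) k + lnbox R (B.*2.+1).
Proof.
move=> k10 k1k kB; rewrite HW_split.
have wP := pweight_prod (pweight_pw w n) (pweight_pw (iter n T w) m).
apply: le_trans (shent_cell (f := fun a => cell k (fw a.1 (fw a.2 (czero R))))
  (Y := fun a => fw a.1 (czero R)) (k := k1) wP _) => [|a b].
  by case: wP => w0 w1; apply: le_shent => // a b [e1 e2 e3 e4]; rewrite /cell e1 e2 e3 e4.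
move=> /cell_eq; rewrite (fw_affine a.1) (fw_affine b.1) /cadd /= => -[H1 H2].
have [a1 a2] := Lam_fw_le w n a.2; have [b1 b2] := Lam_fw_le w n b.2.
rewrite -addn1 natrD -muln2 natrM [_ + 1]addrC [B%:R * _]mulr_natr; split.
  exact: (close_translate k10 k1k H1 a1 b1 kB).
exact: (close_translate k10 k1k H2 a2 b2 kB).
Qed.

(** Chain rule over the coarse cells of the prefix, with [conv_lower] applied inside each of
    them. *)
Lemma pair_lower (w : Omega i0) n m k1 k :
  HW w n k1 + Zent w n m k <=
  shent (prodw (@pw w n) (@pw (iter n T w) m))
    (fun a => (cell k1 (fw a.1 (czero R)), cell k (fw a.1 (fw a.2 (czero R))))) +
  lnbox R 1.
Proof.
have [c0 c1] := pweight_pw w n; have qP := pweight_pw (iter n T w) m.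
have := shent_mean_cond (conj c0 c1) qP (fun u => cell k1 (fw u (czero R)))
  (fun a => cell k (fw a.1 (fw a.2 (czero R)))).
rewrite -/(HW w n k1) => E.
suff : \sum_(u : Xw J w n) pw u * (Zent w n m k - lnbox R 1) <=
    \sum_(u : Xw J w n) pw u * shent (prodw (cond (@pw w n)
      (fun u => cell k1 (fw u (czero R))) (cell k1 (fw u (czero R))))
      (@pw (iter n T w) m)) (fun a => cell k (fw a.1 (fw a.2 (czero R)))).
  by rewrite E -mulr_suml c1; lra.
apply: ler_sum_weight => // u u0; rewrite lerBlDr.
under [X in _ <= shent _ X + _]funext do rewrite fw_affine.
apply: (conv_lower (fun u => fw u (czero R))
  (fun v => cmul (Lam w n) (fw v (czero R))) k _ qP).
exact: (pweight_cond c0 (fun u => cell k1 (fw u (czero R))) u0).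
Qed.

(** Undoing the similarity [Lam w n], a cell of side [1/k] controls the suffix point at the natural
    scale of its word, up to [c] units. *)
Lemma sigma_le_Zent (w : Omega i0) n m k (c : nat) :
  0 < k -> 2 <= c%:R * (k * rho w (n + m)) ->
  sigma (iter n T w) m <= Zent w n m k + lnbox R c.
Proof.
move=> k0 kc; apply: shent_cell_le; first exact: pweight_pw.
move=> a b ab; set r' := rho (iter n T w) m.
have r'0 : 0 < r' := rho_gt0 _ _.
have H : r'^-1 * cnorm (fw a (czero R) - fw b (czero R)) <= c%:R.
  apply: close_cmul ab _ => //; first by rewrite invr_ge0 ltW.
    by rewrite cnorm_Lam rho_gt0.
  by rewrite cnorm_Lam ler_pdivrMr// (le_trans kc)// rho_add !mulrA.
rewrite -!mulrBr !normrM gtr0_norm ?invr_gt0//.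
split; apply: le_trans H; rewrite ler_pM2l ?invr_gt0//.
  exact: (ler_cnorm1 (_ - _)).
exact: (ler_cnorm2 (_ - _)).
Qed.

Lemma rho_le1 (w : nat -> I) n : rho w n <= 1.
Proof.
rewrite /rho; elim/big_rec: _ => // m x _ x1.
by have /andP[m0 m1] := r01 (w m); nra.
Qed.

(** The three constants pay for convolution with the prefix, for undoing the rotation in [Lam w n],
    and for recovering the prefix cell from the full point. *)
Lemma sigma_superadd (w : Omega i0) n m (B : nat) : Rad <= B%:R ->
  sigma w n + sigma (iter n T w) m <=
  sigma w (n + m) + (lnbox R 1 + lnbox R 2 + lnbox R (B.*2.+1)).
Proof.
move=> RB; have [r0 r1] := (rho_gt0 w n, rho_gt0 w (n + m)).
have H1 := pair_lower w n m (rho w n)^-1 (rho w (n + m))^-1.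
have H2 : shent (prodw (@pw w n) (@pw (iter n T w) m))
    (fun a => (cell (rho w n)^-1 (fw a.1 (czero R)),
      cell (rho w (n + m))^-1 (fw a.1 (fw a.2 (czero R))))) <=
    HW w (n + m) (rho w (n + m))^-1 + lnbox R (B.*2.+1).
  apply: pair_upper; first by rewrite invr_gt0.
    by rewrite lef_pV2 ?posrE// rho_add ler_piMr ?rho_le1//; exact: ltW.
  by rewrite mulrA mulVf ?mul1r// gt_eqF.
have H3 : sigma (iter n T w) m <= Zent w n m (rho w (n + m))^-1 + lnbox R 2.
  by apply: sigma_le_Zent; rewrite ?invr_gt0// mulVf ?mulr1// gt_eqF.
rewrite -/(sigma w n) in H1; rewrite -/(sigma w (n + m)) in H2; lra.
Qed.

Lemma HW_le_sigma (w : Omega i0) n k (B : nat) : 0 < k -> k * rho w n <= B%:R ->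
  HW w n k <= sigma w n + lnbox R B.
Proof.
move=> k0 kB; have r0 := rho_gt0 w n.
apply: shent_cell_le; first exact: pweight_pw.
move=> a b /cell_eq[]; rewrite -!mulrBr !normrM gtr0_norm ?invr_gt0//.
by rewrite !ler_pdivrMl// !mulr1 => H1 H2; split;
  apply: le_trans kB; rewrite ?(gtr0_norm k0) ler_pM2l.
Qed.

Lemma sigma_le_HW (w : Omega i0) n m k (B : nat) : 0 < k ->
  (k * rho w n)^-1 + Rad *+ 2 <= B%:R ->
  sigma w n <= HW w (n + m) k + lnbox R B.
Proof.
move=> k0 kB; have r0 := rho_gt0 w n.
rewrite /sigma (HW_fst w n m) HW_split.
apply: shent_cell_le; first by apply: pweight_prod; exact: pweight_pw.
move=> a b /cell_eq; rewrite (fw_affine a.1) (fw_affine b.1) /cadd /= => -[H1 H2].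
have [a1 a2] := Lam_fw_le w n a.2; have [b1 b2] := Lam_fw_le w n b.2.
suff gen x x' z z' : `|k * (x + z) - k * (x' + z')| <= 1 ->
    `|z| <= rho w n * Rad -> `|z'| <= rho w n * Rad ->
    `|(rho w n)^-1 * x - (rho w n)^-1 * x'| <= B%:R by split; [exact: gen H1 a1 b1|exact: gen H2 a2 b2].
move=> H ze z'e; apply: le_trans kB.
rewrite -mulrBr normrM gtr0_norm ?invr_gt0// ler_pdivrMl//.
rewrite mulrDr invfM mulrCA divff ?gt_eqF// mulr1.
have -> : x - x' = (x + z - (x' + z')) - z + z' by ring.
apply: le_trans (ler_normD _ _) _; rewrite mulr2n mulrDr addrA; apply: lerD => //.
apply: le_trans (ler_normB _ _) _; apply: lerD => //.
by move: H; rewrite -mulrBr normrM gtr0_norm// -ler_pdivlMl// mulr1.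
Qed.

(** Used to move from a multiple [n] of the block length to the index [n + d]: the [d] letters in
    between are charged at the logarithm of the number of their words. *)
Lemma sigma_le_split (w : Omega i0) n d m k (c : nat) : 0 < k ->
  2 <= c%:R * (k * rho w (n + d + m)) ->
  sigma (iter n T w) (d + m) <=
  ln #|Xw J (iter n T w) d|%:R + Zent w (n + d) m k + lnbox R c.
Proof.
move=> k0 kc; set w1 := iter n T w.
have E : iter (n + d) T w = iter d T w1 by rewrite addnC iterD.
have EZ : Zent w (n + d) m k = shent (@pw (iter d T w1) m)
    (fun v => cell k (cmul (Lam w (n + d)) (fw v (czero R)))) by rewrite /Zent E.
rewrite rho_add E in kc.
have wP := pweight_prod (pweight_pw w1 d) (pweight_pw (iter d T w1) m).
have [w0 w1'] := wP.
rewrite /sigma HW_split.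
pose Z := fun a : Xw J w1 d * Xw J (iter d T w1) m =>
  cell k (cmul (Lam w (n + d)) (fw a.2 (czero R))).
apply: le_trans (shent_cell_le (f := fun a => (a.1, Z a)) (c := c) wP _) _ => [a b ab|].
  have ab1 : a.1 = b.1 by case: ab.
  have {ab} : Z a = Z b by case: ab => _ e1 e2; rewrite /Z /cell e1 e2.
  move=> /(@close_cmul _ _ _ _ _ (rho (iter d T w1) m)^-1 c%:R k0).
  rewrite invr_ge0 (ltW (rho_gt0 _ _)) cnorm_Lam rho_gt0 => /(_ isT isT).
  rewrite ler_pdivrMr ?rho_gt0// -!mulrA => /(_ kc) H.
  rewrite ab1 (fw_affine b.1 (fw a.2 _)) (fw_affine b.1 (fw b.2 _)).
  set L := Lam w1 d; have H' : (rho w1 (d + m))^-1 *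
    cnorm (cmul L (fw a.2 (czero R)) - cmul L (fw b.2 (czero R))) <= c%:R.
    rewrite -cmulBr cnormM cnorm_Lam rho_add invfM mulrACA.
    by rewrite mulVf ?mul1r// gt_eqF ?rho_gt0.
  have e1 (z y y' : R * R) : (cadd z y).1 - (cadd z y').1 = (y - y').1.
    by rewrite /cadd /=; ring.
  have e2 (z y y' : R * R) : (cadd z y).2 - (cadd z y').2 = (y - y').2.
    by rewrite /cadd /=; ring.
  rewrite -!mulrBr e1 e2 !normrM gtr0_norm ?invr_gt0 ?rho_gt0//.
  split; apply: le_trans H'; rewrite ler_pM2l ?invr_gt0 ?rho_gt0//.
    exact: ler_cnorm1.
  exact: ler_cnorm2.
rewrite lerD2r; apply: le_trans (shent_pairD w0 w1' (fun a => a.1) Z) _.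
rewrite EZ (shent_prod1 (@pw w1 d) (pweight_pw (iter d T w1) m) id).
rewrite (shent_prod2 (@pw (iter d T w1) m) (pweight_pw w1 d)
  (fun v => cell k (cmul (Lam w (n + d)) (fw v (czero R))))) lerD2r.
by case: (pweight_pw w1 d) => v0 v1; exact: shent_fin.
Qed.

End Words.

(** * Sets whose indicator is a limit of continuous functions *)

Section Approx.
Variable R : realType.
Implicit Types (B : set (R * R)) (F : nat -> R * R -> R).

(* Weak convergence only controls integrals of continuous functions, and the
   boundary of a dyadic square may be charged; pointwise limits of continuous
   functions still determine the mass of half-open squares. *)
Definition capprox B F : Prop :=
  [/\ forall k, continuous (F k), forall k, measurable_fun setT (F k),
      forall k z, 0 <= F k z <= 1 &
      forall z, F k z @[k --> \oo] --> (\1_B z : R)].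

Lemma capprox_measurable B F : capprox B F -> measurable B.
Proof.
move=> [_ mF _ FB]; apply/(measurable_indicP R).
by apply: (measurable_fun_cvg (h := F)) => // z _; exact: FB.
Qed.

Lemma capprox_integral B F (mu : probability (R * R)%type R) : capprox B F ->
  (\int[mu]_z (F k z)%:E)%E @[k --> \oo] --> mu B.
Proof.
move=> BF; have mB := capprox_measurable BF; case: BF => [_ mF F01 FB].
rewrite -[B in mu B]setIT -integral_indic//.
apply: (@dominated_cvg _ _ _ mu setT measurableT (fun k z => (F k z)%:E)
  (fun z => (\1_B z)%:E) (cst 1%E)) => //.
- by move=> k; apply/measurable_EFinP; exact: mF.
- by move=> z _; apply: cvg_EFin; [exact: nearW|exact: FB].
- apply: finite_measure_integrable_cst => //.
- move=> k z _ /=; rewrite lee_fin; have /andP[? ?] := F01 k z.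
  by rewrite ger0_norm.
Qed.

Lemma capprox_comp B F (g : R * R -> R * R) : continuous g ->
  measurable_fun setT g -> capprox B F -> capprox (g @^-1` B) (fun k => F k \o g).
Proof.
move=> cg mg [cF mF F01 FB]; split=> [k z|k|k z|z].
- by apply: continuous_comp; [exact: cg|exact: cF].
- exact: measurableT_comp.
- exact: F01.
- exact: FB.
Qed.

Lemma capproxI B B' F F' : capprox B F -> capprox B' F' ->
  capprox (B `&` B') (fun k z => F k z * F' k z).
Proof.
move=> [cF mF F01 FB] [cF' mF' F01' FB']; split=> [k z|k|k z|z].
- by apply: cvgM; [exact: cF|exact: cF'].
- exact: measurable_funM.
- have /andP[a0 a1] := F01 k z; have /andP[b0 b1] := F01' k z.
  by rewrite mulr_ge0//= mulr_ile1.
- rewrite indicI; exact: cvgM.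
Qed.

Definition clamp (x : R) : R := Num.max 0 (Num.min 1 x).

Lemma clamp01 x : 0 <= clamp x <= 1.
Proof. by rewrite /clamp le_max lexx /= ge_max ler01 ge_min lexx. Qed.

Lemma clamp_le0 x : x <= 0 -> clamp x = 0.
Proof.
by move=> x0; rewrite /clamp; apply: max_l; rewrite ge_min x0 orbT.
Qed.

Lemma clamp_ge1 x : 1 <= x -> clamp x = 1.
Proof. by move=> x1; rewrite /clamp min_l// max_r. Qed.

Lemma continuous_clamp (f : R * R -> R) : continuous f -> continuous (clamp \o f).
Proof.
move=> cf z; apply: (@continuous_max R _ (cst 0) (fun z => Num.min 1 (f z))).
  exact: cst_continuous.
apply: (@continuous_min R _ (cst 1) f); first exact: cst_continuous.
exact: cf.
Qed.

Lemma measurable_clamp (f : R * R -> R) :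
  measurable_fun setT f -> measurable_fun setT (clamp \o f).
Proof.
move=> mf; apply: (@measurable_maxr _ _ _ _ (cst 0) (fun z => Num.min 1 (f z))) => //.
by apply: (@measurable_minr _ _ _ _ (cst 1) f).
Qed.

Lemma capprox_gt0 (f : R * R -> R) : continuous f -> measurable_fun setT f ->
  capprox [set z | 0 < f z] (fun k => clamp \o (fun z => k%:R * f z)).
Proof.
move=> cf mf; split=> [k|k|k z|z].
- by apply: continuous_clamp => z; apply: cvgM; [exact: cvg_cst|exact: cf].
- by apply: measurable_clamp; exact: measurable_funM.
- exact: clamp01.
- apply: cvg_near_cst; rewrite indicE; case: (ltP 0 (f z)) => fz.
    rewrite mem_set//; near=> k; apply: clamp_ge1.
    rewrite -ler_pdivrMr// mul1r; near: k; exact: nbhs_infty_ger.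
  rewrite memNset/=; last by rewrite ltNge fz.
  by near=> k; apply: clamp_le0; rewrite mulr_ge0_le0.
Unshelve. all: by end_near. Qed.

(** The ramp is shifted by one so that it equals one on the whole closed side; where [f z < 0] it
    vanishes from [k >= -1 / f z] on. *)
Lemma capprox_ge0 (f : R * R -> R) : continuous f -> measurable_fun setT f ->
  capprox [set z | 0 <= f z] (fun k => clamp \o (fun z => 1 + k%:R * f z)).
Proof.
move=> cf mf; split=> [k|k|k z|z].
- apply: continuous_clamp => z; apply: cvgD; first exact: cvg_cst.
  by apply: cvgM; [exact: cvg_cst|exact: cf].
- by apply: measurable_clamp; apply: measurable_funD => //; exact: measurable_funM.
- exact: clamp01.
- apply: cvg_near_cst; rewrite indicE; case: (leP 0 (f z)) => fz.
    rewrite mem_set//; near=> k; apply: clamp_ge1.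
    by rewrite lerDl mulr_ge0.
  rewrite memNset/=; last by rewrite leNgt fz.
  near=> k; apply: clamp_le0.
  rewrite -lerBrDl sub0r -ler_ndivrMr// mulN1r -invrN.
  near: k; exact: nbhs_infty_ger.
Unshelve. all: by end_near. Qed.

Lemma continuous_affine (a b c : R) : continuous (fun z : R * R => a * z.1 + b * z.2 + c).
Proof.
move=> z; apply: cvgD; last exact: cvg_cst.
apply: cvgD; apply: cvgM; (try exact: cvg_cst); [exact: cvg_fst|exact: cvg_snd].
Qed.

Lemma measurable_affine (a b c : R) :
  measurable_fun setT (fun z : R * R => a * z.1 + b * z.2 + c).
Proof. by repeat apply: measurable_funD; try apply: measurable_funM. Qed.

Lemma continuous_cmap (x L : R * R) : continuous (fun z => cadd x (cmul L z)).
Proof.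
have e : (fun z => cadd x (cmul L z)) = (fun z : R * R =>
    (L.1 * z.1 + - L.2 * z.2 + x.1, L.2 * z.1 + L.1 * z.2 + x.2)).
  by apply/funext => z; rewrite /cadd /cmul /=; congr pair; ring.
rewrite e => z.
apply: (@cvg_pair _ _ _ _ (nbhs (L.1 * z.1 + - L.2 * z.2 + x.1))
  (nbhs (L.2 * z.1 + L.1 * z.2 + x.2))); exact: continuous_affine.
Qed.

Lemma measurable_cmap (x L : R * R) :
  measurable_fun setT (fun z : R * R => cadd x (cmul L z)).
Proof.
have e : (fun z => cadd x (cmul L z)) = (fun z : R * R =>
    (L.1 * z.1 + - L.2 * z.2 + x.1, L.2 * z.1 + L.1 * z.2 + x.2)).
  by apply/funext => z; rewrite /cadd /cmul /=; congr pair; ring.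
rewrite e; apply: measurable_fun_pair; exact: measurable_affine.
Qed.

(** A half-open square is cut out by two closed and two open half-planes, and [capprox] is stable
    under intersection. *)
Lemma capprox_dsq k ab : exists F, capprox (@dsq R k ab) F.
Proof.
have -> : @dsq R k ab =
  ([set z | 0 <= 2 ^+ k * z.1 + 0 * z.2 + - ab.1%:~R] `&`
   [set z | 0 < - 2 ^+ k * z.1 + 0 * z.2 + (ab.1%:~R + 1)]) `&`
  ([set z | 0 <= 0 * z.1 + 2 ^+ k * z.2 + - ab.2%:~R] `&`
   [set z | 0 < 0 * z.1 + - 2 ^+ k * z.2 + (ab.2%:~R + 1)]).
  have fl (x : R) (m : int) : Num.floor x = m <-> 0 <= x - m%:~R /\ 0 < - x + (m%:~R + 1).
    split=> [<-|[H1 H2]]; first by have := floor_itv x; rewrite intrD; lra.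
    by apply/eqP; rewrite floor_eq intrD; lra.
  apply/seteqP; split=> z; rewrite /dsq /= !fl !mul0r !mulNr ?addr0 ?add0r; tauto.
eexists; apply: capproxI; apply: capproxI;
  [apply: capprox_ge0|apply: capprox_gt0|apply: capprox_ge0|apply: capprox_gt0];
  solve [exact: continuous_affine|exact: measurable_affine].
Qed.

End Approx.

(** * Dyadic entropy of a discrete measure blurred at the scale of the grid *)

Section Bridge.
Variable R : realType.

Lemma shent_values (A : finType) (w : A -> R) (T : eqType) (f : A -> T) (s : seq T) :
  uniq s -> (forall a, f a \in s) ->
  shent w f = - \sum_(y <- s) prb w f y * ln (prb w f y).
Proof.
move=> us fs; congr (- _).
under [RHS]eq_bigr do rewrite {1}/prb mulr_suml big_mkcond /=.
rewrite exchange_big /=; apply: eq_bigr => a _.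
rewrite (bigD1_seq (f a))//= eqxx big1 ?addr0// => y.
by rewrite eq_sym => /negbTE ->.
Qed.

Lemma dsqE k ab (z : R * R) : dsq k ab z <-> cell (2 ^+ k) z = ab.
Proof.
by case: ab => a b; rewrite /dsq /cell /=; split=> [[-> ->]|[-> ->]].
Qed.

Lemma ent_termE (x : R) : ent_term x = - (x * ln x) / ln 2.
Proof.
rewrite /ent_term /log2; case: eqP => [->|_]; first by rewrite mul0r oppr0 mul0r.
by rewrite mulrA mulNr.
Qed.

Lemma entropy_finite (A : finType) (w : A -> R) (f : A -> int * int)
    (mu : set (R * R) -> \bar R) k : pweight w ->
  (forall ab, fine (mu (dsq k ab)) = prb w f ab) ->
  entropy mu k = (shent w f / ln 2)%:E.
Proof.
move=> [w0 w1] muE; set s := undup [seq f a | a : A].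
have us : uniq s := undup_uniq _.
have fs a : f a \in s by rewrite mem_undup map_f ?mem_enum.
have prb0 ab : ab \notin s -> prb w f ab = 0.
  move=> abs; rewrite /prb big1// => a /eqP fa.
  by move: abs; rewrite -fa fs.
have ln2 : 0 < ln 2 :> R by apply: ln_gt0; rewrite ltr1n.
have et0 (x : R) : 0 <= x <= 1 -> 0 <= ent_term x.
  move=> /andP[x0 x1]; rewrite ent_termE divr_ge0 ?(ltW ln2)// -mulrN.
  by rewrite mulr_ge0// oppr_ge0 ln_le0.
rewrite /entropy (eq_esum (b := fun ab => if ab \in [set` s]
  then (ent_term (fine (mu (dsq k ab))))%:E else 0%E)); last first.
  move=> ab _; case: ifPn => //; rewrite mem_setE => /prb0 abs.
  by rewrite muE abs /ent_term eqxx.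
rewrite -esum_mkcond esum_fset//; last first.
  by move=> ab _; rewrite lee_fin muE et0// prb_ge0// prb_le1.
  exact: finite_seq.
rewrite -fsbig_seq//.
rewrite sumEFin; congr EFin.
rewrite (shent_values w us fs) mulNr mulr_suml -sumrN; apply: eq_bigr => ab _.
by rewrite muE ent_termE mulNr.
Qed.

(* The grid cell of [pt v + Q z] differs from that of [pt v] by an offset in
   {-1, 0, 1}^2; the joint law of [v] and the offset is a finite coupling. *)
Lemma entropy_bridge (V : finType) (c : V -> R) (pt : V -> R * R)
    (zeta : probability (R * R)%type R) (Q : R * R -> R * R) (S : set (R * R)) k
    (mu : set (R * R) -> \bar R) : pweight c ->
  measurable S -> zeta (~` S) = 0%E ->
  (forall z, S z -> `|2 ^+ k * (Q z).1| <= 1 /\ `|2 ^+ k * (Q z).2| <= 1) ->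
  (forall v ab, measurable [set z | dsq k ab (cadd (pt v) (Q z))]) ->
  (forall ab, mu (dsq k ab) =
    (\sum_v (c v)%:E * zeta [set z | dsq k ab (cadd (pt v) (Q z))])%E) ->
  exists2 h, entropy mu k = h%:E &
    `|h * ln 2 - shent c (fun v => cell (2 ^+ k) (pt v))| <= lnbox R 1.
Proof.
move=> [c0 c1] mS zS QS mB muE.
pose O := ('I_3 * 'I_3)%type.
pose cl v (o : O) : int * int := ((cell (2 ^+ k) (pt v)).1 + (o.1%:Z - 1),
  (cell (2 ^+ k) (pt v)).2 + (o.2%:Z - 1)).
pose B v ab := [set z | dsq k ab (cadd (pt v) (Q z))].
pose m v ab := fine (zeta (B v ab)).
have mE v ab : zeta (B v ab) = (m v ab)%:E.
  by rewrite /m fineK//; apply: fin_num_measure; exact: mB.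
have m0 v ab : 0 <= m v ab by rewrite /m fine_ge0.
have cl_inj v o o' : cl v o = cl v o' -> o = o'.
  case: o o' => [i1 i2] [j1 j2] [/= e1 e2].
  by congr pair; apply: val_inj => /=; lia.
have inS v z : S z -> exists o, B v (cl v o) z.
  move=> /QS[]; set x := (Q z).1; set y := (Q z).2 => hx hy.
  have off (a b : R) : `|2 ^+ k * b| <= 1 ->
      exists o : 'I_3, Num.floor (2 ^+ k * (a + b)) = Num.floor (2 ^+ k * a) + (o%:Z - 1).
    move=> hb; have : `|2 ^+ k * (a + b) - 2 ^+ k * a| <= 1%:R.
      by rewrite mulrDr addrAC subrr add0r.
    move=> /floor_dist hf.
    exists (inord `|(Num.floor (2 ^+ k * (a + b)) - Num.floor (2 ^+ k * a) + 1)%R|%N).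
    by rewrite inordK; lia.
  have [i1 e1] := off (pt v).1 x hx; have [i2 e2] := off (pt v).2 y hy.
  by exists (i1, i2); rewrite /B /= dsqE /cell /cl /= e1 e2.
have msum v : \sum_(o : O) m v (cl v o) = 1.
  have tB : trivIset setT (fun o : O => B v (cl v o)).
    apply/trivIsetP => o o' _ _ oo'; rewrite -subset0 => z [].
    by rewrite /B /= !dsqE => -> /cl_inj e; move: oo'; rewrite e eqxx.
  have mO (o : O) : [set: O] o -> measurable (B v (cl v o)) by move=> _; exact: mB.
  have H := measure_fin_bigcup zeta (@finite_finset _ setT) tB mO.
  have H1 : zeta (\bigcup_(o in [set: O]) B v (cl v o)) = 1%E.
    apply/eqP; rewrite eq_le probability_le1/=; last exact: (fin_bigcup_measurable finite_finset mO).
    have <- : zeta S = 1%E.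
      have := probability_setC zeta mS; rewrite zS => /esym/eqP.
      rewrite -(@fineK _ (zeta S)) ?fin_num_measure// -EFinB eqe subr_eq0 => /eqP <- //.
    rewrite le_measure ?inE//; first exact: (fin_bigcup_measurable finite_finset mO).
    by move=> z /(inS v)[i Bi]; exists i.
  apply: EFin_inj; rewrite -sumEFin -H1 H.
  rewrite (_ : setT = [set` index_enum O]); last first.
    by apply/seteqP; split=> o //= _; rewrite mem_index_enum.
  rewrite -fsbig_seq ?index_enum_uniq//; apply: eq_bigr => o _.
  exact: esym (mE v (cl v o)).
(* A cell that is not a neighbour is reached only from outside [S], which is null. *)
have mout v ab : (forall o, cl v o != ab) -> m v ab = 0.
  move=> H; apply: EFin_inj; rewrite -mE; apply/eqP; rewrite -measure_le0 -zS.
  rewrite le_measure ?inE//; [exact: mB|exact: measurableC|].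
  move=> z Bz /(inS v)[i Bi]; have := H i; apply/negP; rewrite negbK; apply/eqP.
  by move: Bz Bi; rewrite /B /= !dsqE => -> ->.
pose W (a : V * O) := c a.1 * m a.1 (cl a.1 a.2).
have W0 a : 0 <= W a by rewrite mulr_ge0.
have sumW (F : V -> O -> R) : \sum_a W a * F a.1 a.2 =
    \sum_v c v * \sum_o m v (cl v o) * F v o.
  rewrite -(pair_bigA _ (fun v o => c v * m v (cl v o) * F v o))/=.
  apply: eq_bigr => v _; rewrite mulr_sumr.
  by apply: eq_bigr => o _; rewrite mulrA.
have W1 : \sum_a W a = 1.
  under eq_bigr do rewrite -[W _]mulr1.
  rewrite (sumW (fun _ _ => 1)) -[RHS]c1; apply: eq_bigr => v _.
  by under eq_bigr do rewrite mulr1; rewrite msum mulr1.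
pose f (a : V * O) := cl a.1 a.2.
have fE ab : fine (mu (dsq k ab)) = prb W f ab.
  rewrite muE.
  under eq_bigr do rewrite -/(B _ _) mE -EFinM.
  rewrite sumEFin /= /prb.
  transitivity (\sum_a W a * (f a == ab)%:R); last first.
    by rewrite [RHS]big_mkcond; apply: eq_bigr => a _; case: eqP; rewrite (mulr1, mulr0).
  rewrite (sumW (fun v o => (cl v o == ab)%:R)); apply: eq_bigr => v _; congr (_ * _).
  case: (pickP (fun o => cl v o == ab)) => [i /eqP oab|no].
    rewrite (bigD1 i)//= oab eqxx mulr1 big1 ?addr0// => o' oo'.
    rewrite (_ : _ == _ = false) ?mulr0//; apply/negbTE; apply: contra oo' => /eqP.
    by rewrite -oab => /cl_inj ->.
  by rewrite mout ?big1// => o; rewrite ?no ?mulr0.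
exists (shent W f / ln 2); first exact: entropy_finite.
rewrite divfK; last by rewrite gt_eqF// ln_gt0// ltr1n.
have -> : shent c (fun v => cell (2 ^+ k) (pt v)) =
    shent W (fun a => cell (2 ^+ k) (pt a.1)).
  apply: shent_law => F; rewrite (sumW (fun v _ => F (cell (2 ^+ k) (pt v)))).
  by apply: eq_bigr => v _; rewrite -mulr_suml msum mul1r.
have card9 : ln #|{: O}|%:R = lnbox R 1 by rewrite card_prod !card_ord.
(* Once the offset is known, the blurred cell and the cell of [pt v] determine each other, so their
   entropies differ by at most the logarithm of the nine offsets. *)
have H1 := shent_pair_fin W0 W1 f (fun a => a.2).
have H2 := shent_pair_fin W0 W1 (fun a => cell (2 ^+ k) (pt a.1)) (fun a => a.2).
have H3 : shent W f <= shent W (fun a => (cell (2 ^+ k) (pt a.1), a.2)).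
  apply: le_shent => // a b ab; have e2 : a.2 = b.2 by case: ab.
  have e1 : cell (2 ^+ k) (pt a.1) = cell (2 ^+ k) (pt b.1).
    by case: ab => e1 e1' _; rewrite /cell e1 e1'.
  by rewrite /f /cl e1 e2.
have H4 : shent W (fun a => cell (2 ^+ k) (pt a.1)) <= shent W (fun a => (f a, a.2)).
  apply: le_shent => // a b [/= e1 e2 e3]; rewrite /cell.
  by move: e1 e2; rewrite e3 /cell /= => /addIr -> /addIr ->.
rewrite -card9 ler_norml; lra.
Qed.

End Bridge.

(** * Measurability on the sequence space *)

Section SeqMeasurable.
Variables (I : finType) (i0 : I).
Local Notation T := (@shift I i0).

Lemma measurable_coord m (i : I) : measurable [set w : Omega i0 | w m = i].
Proof. by apply: sub_sigma_algebra; exists m, i. Qed.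

Lemma measurable_shift : measurable_fun setT T.
Proof.
apply: (@measurability _ _ _ _ setT T (@cylinders I i0)) => //.
move=> _ [_ [m [i ->]] <-]; rewrite setTI; exact: (measurable_coord m.+1 i).
Qed.

Lemma measurable_iter_shift n : measurable_fun setT (iter n T).
Proof.
elim: n => [|n IH]; first exact: measurable_id.
exact: (measurableT_comp measurable_shift IH).
Qed.

(** There are finitely many prefixes of length [n]. The set [E0] need not be constant on a cylinder:
    freezing the prefix fixes the word space and [Lam], while [eta] at the shifted sequence still
    varies with the tail. *)
Lemma measurable_glue n (E : set (Omega i0)) :
  (forall w0 : Omega i0, exists2 E0 : set (Omega i0), measurable E0 &
    forall w : Omega i0, (forall i, (i < n)%N -> w i = w0 i) -> (E w <-> E0 w)) ->
  measurable E.
Proof.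
move=> HE.
pose ext (s : {ffun 'I_n -> I}) : Omega i0 :=
  fun m => if insub m is Some k then s k else i0.
have [E0 mE0 EE0] : exists2 E0 : {ffun 'I_n -> I} -> set (Omega i0),
    forall s, measurable (E0 s) & forall s (w : Omega i0),
    (forall i, (i < n)%N -> w i = ext s i) -> (E w <-> E0 s w).
  have /choice[f fP] : forall s, exists E0 : set (Omega i0), measurable E0 /\
      forall w : Omega i0, (forall i, (i < n)%N -> w i = ext s i) -> (E w <-> E0 w).
    by move=> s; have [E0 ? ?] := HE (ext s); exists E0.
  by exists f => [s|s w]; have [mf fE] := fP s; [exact: mf|exact: fE].
have -> : E = \bigcup_(s in setT) (E0 s `&` \bigcap_(i in [set: 'I_n]) [set w : Omega i0 | w i = s i]).
  apply/seteqP; split=> [w Ew|w [s _ [Es sw]]].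
    exists [ffun i : 'I_n => w i] => //.
    have pre i : (i < n)%N -> w i = ext [ffun i : 'I_n => w i] i.
      by move=> lt; rewrite /ext insubT /= ffunE.
    by split; [apply/(EE0 _ _ pre)|move=> i _ /=; rewrite ffunE].
  apply/(EE0 s) => // i lt; rewrite /ext insubT /=.
  exact: (sw (Ordinal lt)).
apply: fin_bigcup_measurable => [|s _]; first exact: finite_finset.
apply: measurableI => //; apply: fin_bigcap_measurable => [|i _].
  exact: finite_finset.
exact: measurable_coord.
Qed.

Lemma measurable_prefix n (E : set (Omega i0)) :
  (forall w w' : Omega i0, (forall i, (i < n)%N -> w i = w' i) -> E w -> E w') ->
  measurable E.
Proof.
move=> HE; apply: (measurable_glue (n := n)) => w0; have [Ew0|nEw0] := pselect (E w0).
  by exists setT => // w ww0; split=> // _; apply: HE Ew0 => i /ww0.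
by exists set0 => // w ww0; split=> //; move/(HE _ _ ww0).
Qed.

Lemma measurable_fun_glue n d (S : measurableType d) (g : Omega i0 -> S) :
  (forall w0 : Omega i0, exists2 g0 : Omega i0 -> S, measurable_fun setT g0 &
    forall w : Omega i0, (forall i, (i < n)%N -> w i = w0 i) -> g w = g0 w) ->
  measurable_fun setT g.
Proof.
move=> Hg _ Y mY; rewrite setTI; apply: (measurable_glue (n := n)) => w0.
have [g0 mg0 gg0] := Hg w0; exists (g0 @^-1` Y).
  by rewrite -[X in measurable X]setTI; exact: mg0.
by move=> w /gg0; rewrite /preimage /= => ->.
Qed.

Lemma measurable_fun_prefix n d (S : measurableType d) (g : Omega i0 -> S) :
  (forall w w' : Omega i0, (forall i, (i < n)%N -> w i = w' i) -> g w = g w') ->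
  measurable_fun setT g.
Proof.
move=> Hg; apply: (measurable_fun_glue (n := n)) => w0; exists (cst (g w0)) => //.
by move=> w /Hg.
Qed.

End SeqMeasurable.

Section EntropyMeasurable.
Variables (R : realType) (d : measure_display) (S : measurableType d).

(** Enumerating the index pairs through [pickle] turns [esum] into a countable series of nonnegative
    measurable terms; the default [(0, 0)] is not met on [Q]. *)
Lemma measurable_entropy (mu : S -> set (R * R) -> \bar R) k :
  (forall ab, measurable_fun setT (fun s => fine (mu s (dsq k ab)))) ->
  (forall s ab, 0 <= fine (mu s (dsq k ab)) <= 1) ->
  measurable_fun setT (fun s => entropy (mu s) k).
Proof.
move=> mmu mu01.
pose e (n : nat) : int * int := odflt (0, 0) (pickle_inv n).
pose Q : set nat := [set n | (pickle_inv n : option (int * int))].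
have eQ : e @` Q = setT.
  apply/seteqP; split=> // ab _; exists (pickle ab); rewrite /Q /e /= pickleK_inv //.
have einj : set_inj Q e.
  move=> m n; rewrite !inE /Q /e /= => + + .
  have := @pickle_invK (int * int)%type m; have := @pickle_invK (int * int)%type n.
  case: (pickle_inv m) (pickle_inv n) => [x|] [y|] //= <- <- _ _ -> //.
have et0 s ab : (0 <= (ent_term (fine (mu s (dsq k ab))))%:E)%E.
  have /andP[x0 x1] := mu01 s ab.
  rewrite lee_fin ent_termE divr_ge0 ?ln_ge0 ?ler1n// -mulrN.
  by rewrite mulr_ge0// oppr_ge0 ln_le0.
rewrite /entropy -eQ.
under eq_fun do rewrite esum_set_image//.
apply: (@ge0_emeasurable_sum _ _ _ setT
  (fun n s => (ent_term (fine (mu s (dsq k (e n)))))%:E) (fun n => n \in Q)) => // n _.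
apply/measurable_EFinP.
under eq_fun do rewrite ent_termE.
apply: measurable_funM => //; apply: measurableT_comp => //.
by apply: measurable_funM => //; apply: measurableT_comp => //; exact: measurable_ln.
Qed.

End EntropyMeasurable.

(** * The limit measures *)

Section Eta.
Variables (R : realType) (I : finType) (i0 : I) (J : I -> finType).
Variables (p : forall i, J i -> R) (t : forall i, J i -> R * R)
          (r : I -> R) (phi : I -> R * R) (Rad : R).
Variable eta : Omega i0 -> probability (R * R)%type R.

Local Notation T := (@shift I i0).
Local Notation fw := (fw t r phi).
Local Notation pw := (pw p).
Local Notation fmp := (fmp t r phi).
Local Notation Lam := (Lam r phi).
Local Notation rho := (rho r).
Local Notation Eg := (Eg p t r phi).
Local Notation HW := (HW p t r phi).
Local Notation Zent := (Zent p t r phi).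

Hypothesis p0 : forall i (j : J i), 0 < p j.
Hypothesis p1 : forall i, \sum_(j : J i) p j = 1.
Hypothesis Rad0 : 0 < Rad.
Hypothesis r01 : forall i, 0 < r i < 1.
Hypothesis phi1 : forall i, cnorm (phi i) = 1.
Hypothesis fball : forall i (j : J i) z, cnorm z < Rad -> cnorm (fmp j z) < Rad.
Hypothesis eta_lim : is_eta p t r phi eta.

Let pwP (w : Omega i0) n : pweight (@Defs.pw R I J p w n).
Proof. exact: (pweight_pw t r phi p0 p1). Qed.

Lemma eta_cvg (w : Omega i0) (F : R * R -> R) : continuous F ->
  (forall z, 0 <= F z <= 1) ->
  (Eg w n (fun f => F (f (czero R))))%:E @[n --> \oo] --> (\int[eta w]_z (F z)%:E)%E.
Proof.
move=> cF F01; apply: eta_lim => //; exists 1 => z.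
by have /andP[? ?] := F01 z; rewrite ger0_norm.
Qed.

(** Words of length [m + n] split at [m]; the first [m] letters stay fixed while [n] tends to
    infinity. Only weak convergence is available, so the identity is first obtained for continuous
    [F]. *)
Lemma eta_selfsim_int (w : Omega i0) m (F : R * R -> R) : continuous F ->
  (forall z, 0 <= F z <= 1) ->
  (\int[eta w]_z (F z)%:E =
   \sum_(u : Xw J w m) (pw u)%:E * \int[eta (iter m T w)]_z (F (fw u z))%:E)%E.
Proof.
move=> cF F01.
have fwE (u : Xw J w m) : fw u = fun z => cadd (fw u (czero R)) (cmul (Lam w m) z).
  by apply/funext => z; rewrite fw_affine.
have cfw (u : Xw J w m) : continuous (fun z => F (fw u z)).
  rewrite fwE => z; apply: (@continuous_comp _ _ _
    (fun z => cadd (fw u (czero R)) (cmul (Lam w m) z)) F).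
    exact: continuous_cmap.
  exact: cF.
have H1 : (Eg w (m + n) (fun f => F (f (czero R))))%:E @[n --> \oo] -->
    (\int[eta w]_z (F z)%:E)%E.
  exact: (cvg_comp _ _ (cvg_addnl m) (eta_cvg (w := w) cF F01)).
have H2 : (Eg w (m + n) (fun f => F (f (czero R))))%:E @[n --> \oo] -->
   (\sum_(u : Xw J w m) (pw u)%:E * \int[eta (iter m T w)]_z (F (fw u z))%:E)%E.
  have -> : (fun n => (Eg w (m + n) (fun f => F (f (czero R))))%:E) =
     (fun n => (\sum_(u : Xw J w m) (pw u)%:E *
        (Eg (iter m T w) n (fun g => F (fw u (g (czero R)))))%:E)%E).
    apply/funext => n; rewrite Eg_add /Eg -sumEFin.
    by apply: eq_bigr => u _; rewrite EFinM.
  apply: cvg_nnesum => u _.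
    apply: nearW => n; rewrite -EFinM lee_fin mulr_ge0 ?(proj1 (pwP _ _))//.
    apply: sumr_ge0 => v _; rewrite mulr_ge0 ?(proj1 (pwP _ _))//.
    by case/andP: (F01 (fw u (fw v (czero R)))).
  apply: cvgeZl => //; apply: (eta_cvg (w := iter m T w) (cfw u)) => z.
  exact: F01.
exact: (cvg_unique _ H1 H2).
Qed.

Lemma eta_selfsim (w : Omega i0) m (B : set (R * R)) F : capprox B F ->
  eta w B = (\sum_(u : Xw J w m) (pw u)%:E * eta (iter m T w) (fw u @^-1` B))%E.
Proof.
move=> BF; have [cF mF F01 _] := BF.
have H1 := capprox_integral (mu := eta w) BF.
have H2 : (\int[eta w]_z (F k z)%:E)%E @[k --> \oo] -->
  (\sum_(u : Xw J w m) (pw u)%:E * eta (iter m T w) (fw u @^-1` B))%E.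
  under eq_fun do rewrite (eta_selfsim_int w m (cF _) (F01 _)).
  apply: cvg_nnesum => u _.
    apply: nearW => n; rewrite mule_ge0 ?lee_fin ?(proj1 (pwP _ _))//.
    by apply: integral_ge0 => z _; rewrite lee_fin; case/andP: (F01 n (fw u z)).
  apply: cvgeZl => //.
  have fwE : fw u = fun z => cadd (fw u (czero R)) (cmul (Lam w m) z).
    by apply/funext => z; rewrite fw_affine.
  apply: (@capprox_integral _ _ (fun k => F k \o fw u)).
  by apply: capprox_comp => //; rewrite fwE; [exact: continuous_cmap|exact: measurable_cmap].
exact: (cvg_unique _ H1 H2).
Qed.

Lemma cnorm_leE (z : R * R) : (cnorm z <= Rad) = (z.1 ^+ 2 + z.2 ^+ 2 <= Rad ^+ 2).
Proof.
rewrite /cnorm -{1}(ger0_norm (ltW Rad0)) -sqrtr_sqr ler_sqrt//; exact: sqr_ge0.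
Qed.

(** All atoms lie in the open ball, but a weak limit is only confined to the closed one: the ramps
    approximating the indicator of its complement vanish at every atom. *)
Lemma eta_support (w : Omega i0) : let S := [set z | cnorm z <= Rad] in
  measurable S /\ eta w (~` S) = 0%E.
Proof.
move=> S; pose f (z : R * R) := z.1 * z.1 + z.2 * z.2 - Rad ^+ 2.
have SE : ~` S = [set z | 0 < f z].
  apply/seteqP; split=> z; rewrite /S /f /=.
    by rewrite cnorm_leE !expr2; move/negP; rewrite -ltNge subr_gt0.
  by rewrite cnorm_leE !expr2 subr_gt0 => H; apply/negP; rewrite -ltNge.
have cf : continuous f.
  move=> z; apply: cvgB; last exact: cvg_cst.
  by apply: cvgD; apply: cvgM; solve [exact: cvg_fst|exact: cvg_snd].
have mf : measurable_fun setT f.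
  by apply: measurable_funB => //; apply: measurable_funD; apply: measurable_funM.
have ap := capprox_gt0 cf mf; have mC := capprox_measurable ap.
split; first by rewrite -[S]setCK SE; exact: measurableC.
have [cF mF F01 _] := ap.
have H := capprox_integral (mu := eta w) ap; rewrite SE.
have E k : (\int[eta w]_z (clamp (k%:R * f z))%:E = 0)%E.
  have Hk := eta_cvg (w := w) (cF k) (F01 k).
  have E0 : (fun n => (Eg w n (fun g => clamp (k%:R * f (g (czero R)))))%:E) = fun=> 0%E.
    apply/funext => n; rewrite /Eg big1// => u _.
    rewrite clamp_le0 ?mulr0// mulr_ge0_le0// /f subr_le0 -!expr2 -cnorm_leE.
    by rewrite ltW//; exact: (fw_ball Rad0 fball).
  by rewrite /= E0 in Hk; exact: (cvg_unique _ Hk (cvg_cst _)).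
have E0 : (fun k => \int[eta w]_z (clamp (k%:R * f z))%:E)%E = fun=> 0%E.
  exact/funext.
by rewrite /= E0 in H; exact: (cvg_unique _ H (cvg_cst _)).
Qed.

Lemma measurable_eta (B : set (R * R)) F : capprox B F ->
  measurable_fun setT (fun w => eta w B).
Proof.
move=> BF; have [cF mF F01 _] := BF.
apply: (emeasurable_fun_cvg (fun k w => \int[eta w]_z (F k z)%:E)%E); last first.
  by move=> w _; exact: capprox_integral.
move=> k; apply: (emeasurable_fun_cvg
  (fun n w => (Eg w n (fun f => F k (f (czero R))))%:E)); last first.
  by move=> w _; exact: (eta_cvg (w := w) (cF k) (F01 k)).
move=> n; apply/measurable_EFinP; apply: (measurable_fun_prefix (n := n)) => w w'.
exact: Eg_prefix.
Qed.

Lemma capprox_dsq_map k ab (x L : R * R) :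
  exists F, capprox [set z | dsq k ab (cadd x (cmul L z))] F.
Proof.
have [F HF] := capprox_dsq R k ab; exists (fun n => F n \o (fun z => cadd x (cmul L z))).
by apply: capprox_comp => //; [exact: continuous_cmap|exact: measurable_cmap].
Qed.

(** By self-similarity [eta] at time [n] is an average over [m] further letters of copies of [eta]
    at time [n + m]. With [m] so large that these copies, of radius [rho w (n + m) * Rad], fit below
    the grid, they may be replaced by points at cost [lnbox R 1]. *)
Lemma entropy_conv_tau (U : finType) (c : U -> R) (X : U -> R * R) (w : Omega i0)
    n m k (mu : set (R * R) -> \bar R) : pweight c ->
  2 ^+ k * (rho w (n + m) * Rad) <= 1 ->
  (forall ab, mu (dsq k ab) =
    (\sum_u (c u)%:E * tauw r phi eta w n [set z | dsq k ab (cadd (X u) z)])%E) ->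
  exists2 h, entropy mu k = h%:E &
    `|h * ln 2 - shent (prodw c (@Defs.pw R I J p (iter n T w) m))
      (fun a => cell (2 ^+ k) (cadd (X a.1) (cmul (Lam w n) (fw a.2 (czero R)))))|
    <= lnbox R 1.
Proof.
move=> cP small muE; have [mS eS] := eta_support (iter m T (iter n T w)).
have L2 : 0 < 2 ^+ k :> R by rewrite exprn_gt0.
pose Q z := cmul (Lam w n) (cmul (Lam (iter n T w) m) z).
have mapE u (v : Xw J (iter n T w) m) z : cadd (X u) (cmul (Lam w n) (fw v z)) =
    cadd (cadd (X u) (cmul (Lam w n) (fw v (czero R)))) (Q z).
  by rewrite fw_affine cmul_addr caddA.
apply: (@entropy_bridge _ _ _
  (fun a => cadd (X a.1) (cmul (Lam w n) (fw a.2 (czero R))))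
  (eta (iter m T (iter n T w))) Q _ _ _ (pweight_prod cP (pwP _ _)) mS eS).
- move=> z /= zR; have H : 2 ^+ k * cnorm (Q z) <= 1.
    apply: le_trans small; rewrite ler_pM2l// !cnormM !(cnorm_Lam r01 phi1).
    by rewrite mulrA -rho_add ler_pM2l// rho_gt0.
  split; apply: le_trans H; rewrite normrM (gtr0_norm L2) ler_pM2l//.
    exact: (ler_cnorm1 (Q z)).
  exact: (ler_cnorm2 (Q z)).
- move=> a ab; under eq_set do rewrite /Q cmulA.
  by have [F /capprox_measurable] := capprox_dsq_map k ab
    (cadd (X a.1) (cmul (Lam w n) (fw a.2 (czero R)))) (cmul (Lam w n) (Lam (iter n T w) m)).
- move=> ab; rewrite muE.
  rewrite -(pair_bigA _ (fun u v => (prodw c (@Defs.pw R I J p (iter n T w) m) (u, v))%:E *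
    eta (iter m T (iter n T w)) [set z | dsq k ab
      (cadd (cadd (X u) (cmul (Lam w n) (fw v (czero R)))) (Q z))])%E)/=.
  apply: eq_bigr => u _; rewrite /tauw.
  have [F HF] := capprox_dsq_map k ab (X u) (Lam w n).
  rewrite (eta_selfsim (iter n T w) m HF) ge0_sume_distrr//; last first.
    by move=> v _; rewrite mule_ge0// lee_fin; exact: (proj1 (pwP _ _)).
  apply: eq_bigr => v _; rewrite muleA -EFinM; congr (_ * eta _ _)%E.
  by apply/funext => z; exact: (congr1 (dsq k ab) (mapE u v z)).
Qed.

Lemma cadd0 (z : R * R) : cadd (czero R) z = z.
Proof. by case: z => x y; rewrite /cadd /= !add0r. Qed.

(** * Measurability of the component event *)

Definition tmass (w : Omega i0) n k ab (x : R * R) : R :=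
  fine (eta (iter n T w) [set z | dsq k ab (cadd x (cmul (Lam w n) z))]).

Lemma tmassE (w : Omega i0) n k ab x :
  tauw r phi eta w n [set z | dsq k ab (cadd x z)] = (tmass w n k ab x)%:E.
Proof.
rewrite /tmass fineK//; apply: fin_num_measure.
by have [F /capprox_measurable] := capprox_dsq_map k ab x (Lam w n).
Qed.

Lemma tauw_dsqE (w : Omega i0) n k ab :
  tauw r phi eta w n (dsq k ab) = (tmass w n k ab (czero R))%:E.
Proof.
rewrite -tmassE; congr (tauw _ _ _ _ _ _); apply/funext => z.
by rewrite /mkset cadd0.
Qed.

Lemma tmass01 (w : Omega i0) n k ab x : 0 <= tmass w n k ab x <= 1.
Proof.
rewrite -!lee_fin -tmassE; apply/andP; split; first exact: measure_ge0.
apply: probability_le1.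
by have [F /capprox_measurable] := capprox_dsq_map k ab x (Lam w n).
Qed.

Lemma measurable_tmass n k ab x : measurable_fun setT (fun w : Omega i0 => tmass w n k ab x).
Proof.
apply: (measurable_fun_glue (n := n)) => w0.
have [F HF] := capprox_dsq_map k ab x (Lam w0 n).
exists (fun w => fine (eta (iter n T w) [set z | dsq k ab (cadd x (cmul (Lam w0 n) z))])).
  have m1 := measurableT_comp (measurable_eta HF) (@measurable_iter_shift I i0 n).
  exact: (measurableT_comp (fine_measurable measurableT) m1).
by move=> w ww0; rewrite /tmass (Lam_prefix r phi ww0).
Qed.

Lemma DsqE i (x y : R * R) : `[< Dsq i x y >] = (cell (2 ^+ i) y == cell (2 ^+ i) x).
Proof. by apply/idP/eqP => [/asboolP/dsqE|/dsqE/asboolP]. Qed.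

Lemma comp_convE (w : Omega i0) n x i k ab :
  comp_conv (@Defs.pw R I J p w n) (fun u => fw u (czero R)) x i
    (tauw r phi eta w n) (dsq k ab) =
  (Eg w n (fun f => (cell (2 ^+ i) (f (czero R)) == cell (2 ^+ i) x)%:R *
       tmass w n k ab (f (czero R))) /
   Eg w n (fun f => (cell (2 ^+ i) (f (czero R)) == cell (2 ^+ i) x)%:R))%:E.
Proof.
rewrite /comp_conv.
have -> : dmass (@Defs.pw R I J p w n) (fun u => fw u (czero R)) (Dsq i x) =
    Eg w n (fun f => (cell (2 ^+ i) (f (czero R)) == cell (2 ^+ i) x)%:R).
  rewrite /dmass big_mkcond; apply: eq_bigr => u _; rewrite DsqE.
  by case: eqP; rewrite (mulr1, mulr0).
set e := Eg _ _ (fun f => (_ == _)%:R).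
rewrite mulr_suml -sumEFin big_mkcond; apply: eq_bigr => u _; rewrite DsqE.
case: eqP => _; last by rewrite mul0r mulr0 mul0r.
by rewrite tmassE -EFinM mul1r mulrAC.
Qed.

Lemma measurable_Eg n (g : Omega i0 -> R * R -> R) :
  (forall x, measurable_fun setT (g ^~ x)) ->
  measurable_fun setT (fun w : Omega i0 => Eg w n (fun f => g w (f (czero R)))).
Proof.
move=> mg; apply: (measurable_fun_glue (n := n)) => w0.
exists (fun w => Eg w0 n (fun f => g w (f (czero R)))).
  apply: measurable_sum => u; apply: measurable_funM => //; exact: mg.
by move=> w ww0; exact: Eg_prefix.
Qed.

Lemma measurable_entropy_tau n k :
  measurable_fun setT (fun w : Omega i0 => entropy (tauw r phi eta w n) k).
Proof.
apply: measurable_entropy => [ab|w ab].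
  by under eq_fun do rewrite tauw_dsqE; exact: measurable_tmass.
by rewrite tauw_dsqE; exact: tmass01.
Qed.

Lemma measurable_entropy_comp n x i k :
  measurable_fun setT (fun w : Omega i0 => entropy (comp_conv (@Defs.pw R I J p w n)
    (fun u => fw u (czero R)) x i (tauw r phi eta w n)) k).
Proof.
apply: measurable_entropy => [ab|w ab].
  under eq_fun do rewrite comp_convE /=.
  apply: measurable_funM.
    apply: (@measurable_Eg n (fun w y => (cell (2 ^+ i) y == cell (2 ^+ i) x)%:R *
      tmass w n k ab y)) => y.
    by apply: measurable_funM => //; exact: measurable_tmass.
  apply: (measurable_fun_prefix (n := n)) => w w' ww'; congr (_^-1).
  exact: Eg_prefix.
rewrite comp_convE /=; set b := fun f : R * R -> R * R => (_ == _)%:R.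
have w0 := proj1 (pwP w n).
have E0 : 0 <= Eg w n b by apply: sumr_ge0 => u _; rewrite mulr_ge0.
have t01 y := tmass01 w n k ab y.
rewrite divr_ge0//=; last first.
  apply: sumr_ge0 => u _; rewrite mulr_ge0// mulr_ge0//.
  by case/andP: (t01 (fw u (czero R))).
(* The square around [x] need not be charged; the quotient is then zero by the convention on
   inverses. *)
move: E0; rewrite le_eqVlt => /predU1P[<-|E0]; first by rewrite invr0 mulr0.
rewrite ler_pdivrMr// mul1r; apply: ler_sum => u _; rewrite ler_wpM2l//.
by rewrite ler_piMr//; case/andP: (t01 (fw u (czero R))).
Qed.

Lemma rho_lt (e : R) : 0 < e -> exists m, forall w : nat -> I, rho w m < e.
Proof.
move=> e0.
pose b := \big[Num.max/0]_i r i.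
have rb i : r i <= b by rewrite /b; exact: le_bigmax_cond.
have b1 : b < 1 by apply: bigmax_lt => // i _; case/andP: (r01 i).
have b0 : 0 < b by apply: lt_le_trans (rb i0); case/andP: (r01 i0).
have : \forall m \near \oo, b ^+ m < e.
  have /cvgr_lt : (fun m => b ^+ m) @ \oo --> (0 : R).
    by apply: cvg_expr; rewrite gtr0_norm.
  exact.
move=> [m _ /(_ m (leqnn m)) bm]; exists m => w; apply: le_lt_trans bm.
rewrite /rho -[X in b ^+ X](card_ord m) -prodr_const; apply: ler_prod => i _.
by rewrite rb andbT ltW//; case/andP: (r01 (w i)).
Qed.

Lemma nprimeP (w : Omega i0) n :
  2 * Rad * rho w (nprime r Rad w n) <= (2 ^+ n)^-1 /\
  forall m, (m < nprime r Rad w n)%N -> (2 ^+ n)^-1 < 2 * Rad * rho w m.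
Proof.
rewrite /nprime; case: pselect => [h|[]].
  case: ex_minnP => N HN min; split=> [//|m mN]; rewrite ltNge; apply/negP => /min.
  by rewrite leqNgt mN.
have [|m Hm] := @rho_lt ((2 ^+ n)^-1 / (2 * Rad)).
  by rewrite divr_gt0 ?mulr_gt0// invr_gt0 exprn_gt0.
by exists m; rewrite mulrC -ler_pdivlMr ?mulr_gt0//; exact/ltW/Hm.
Qed.

(** [nprime] is a stopping time: whether it equals [N] is decided by the contractions along the
    first [N] letters. *)
Lemma measurable_nprime n N : measurable [set w : Omega i0 | nprime r Rad w n = N].
Proof.
apply: (measurable_prefix (n := N)) => w w' ww' /= wN.
have [H1 H2] := nprimeP w n; have [H1' H2'] := nprimeP w' n.
have rhoE m : (m <= N)%N -> rho w m = rho w' m.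
  by move=> mN; apply: rho_prefix => i im; apply: ww'; exact: leq_trans im mN.
rewrite wN in H1 H2; apply/eqP; rewrite eqn_leq; apply/andP; split; rewrite leqNgt.
  by apply/negP => /H2'; rewrite -rhoE// ltNge H1.
by apply/negP => lt; have := H2 _ lt; rewrite rhoE ?(ltnW lt)// ltNge H1'.
Qed.

Lemma measurable_Gset eps delta q n : measurable (Gset p t r phi eta Rad eps delta q n).
Proof.
pose A (N : nat) (x : R * R) (i : nat) : set (Omega i0) := [set w |
  (((q * n)%:R^-1)%:E * `|entropy (comp_conv (@Defs.pw R I J p w N)
    (fun u => fw u (czero R)) x i (tauw r phi eta w N)) ((q + 1) * n) -
    entropy (tauw r phi eta w N) ((q + 1) * n)| < delta%:E)%E].
have mA N x i : measurable (A N x i).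
  rewrite -[A N x i]setTI; apply: emeasurable_fun_infty_o => //.
  apply: emeasurable_funM => //; apply: measurableT_comp => //.
  apply: emeasurable_funB; first exact: measurable_entropy_comp.
  exact: measurable_entropy_tau.
(* Splitting over the countably many values of [nprime] makes the word length deterministic;
   [measurable_Eg] then freezes the words, and with them the points [x]. *)
have -> : Gset p t r phi eta Rad eps delta q n = \bigcup_N
    ([set w : Omega i0 | nprime r Rad w n = N] `&`
     [set w : Omega i0 | 1 - eps < Eg w N (fun f => (\1_(A N (f (czero R)) n) w : R))]).
  have PE (w : Omega i0) N : Pcomp (@Defs.pw R I J p w N) (fun u => fw u (czero R)) n
      (fun x i => A N x i w) = Eg w N (fun f => (\1_(A N (f (czero R)) n) w : R)).
    rewrite /Pcomp big_mkcond; apply: eq_bigr => u _; rewrite indicE.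
    case: asboolP => H; first by rewrite mem_set ?mulr1.
    by rewrite memNset ?mulr0.
  apply/seteqP; split.
    move=> w Gw; exists (nprime r Rad w n); first exact: Logic.I.
    by split; [exact: erefl|rewrite /mkset -PE; exact: Gw].
  by move=> w [N _ []]; rewrite /mkset => <-; rewrite -PE; apply.
apply: bigcupT_measurable => N; apply: measurableI; first exact: measurable_nprime.
have mg : measurable_fun setT
    (fun w : Omega i0 => Eg w N (fun f => (\1_(A N (f (czero R)) n) w : R))).
  by apply: (@measurable_Eg N (fun w x => \1_(A N x n) w)) => x; exact: measurable_indic.
rewrite [X in measurable X](_ : _ = setT `&` (fun w : Omega i0 =>
  Eg w N (fun f => (\1_(A N (f (czero R)) n) w : R))) @^-1` `]1 - eps, +oo[%classic).
  by apply: mg => //; exact: measurable_itv.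
by apply/seteqP; split=> w; rewrite /preimage /= in_itv /= andbT; tauto.
Qed.

End Eta.

(** * Entropy increments along a single sequence *)

Section Gap.
Variables (R : realType) (I : finType) (i0 : I) (J : I -> finType).
Variables (p : forall i, J i -> R) (t : forall i, J i -> R * R)
          (r : I -> R) (phi : I -> R * R) (Rad : R).
Variable eta : Omega i0 -> probability (R * R)%type R.

Local Notation T := (@shift I i0).
Local Notation fw := (fw t r phi).
Local Notation pw := (pw p).
Local Notation fmp := (fmp t r phi).
Local Notation Lam := (Lam r phi).
Local Notation rho := (rho r).
Local Notation Eg := (Eg p t r phi).
Local Notation HW := (HW p t r phi).
Local Notation Zent := (Zent p t r phi).
Local Notation sigma := (sigma p t r phi).

Hypothesis p0 : forall i (j : J i), 0 < p j.
Hypothesis p1 : forall i, \sum_(j : J i) p j = 1.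
Hypothesis Rad0 : 0 < Rad.
Hypothesis r01 : forall i, 0 < r i < 1.
Hypothesis phi1 : forall i, cnorm (phi i) = 1.
Hypothesis fball : forall i (j : J i) z, cnorm z < Rad -> cnorm (fmp j z) < Rad.
Hypothesis eta_lim : is_eta p t r phi eta.

Let pwP (w : Omega i0) n : pweight (@Defs.pw R I J p w n).
Proof. exact: (pweight_pw t r phi p0 p1). Qed.

(* Every component satisfies [d u >= - lnbox 1] while the mean of [d] is at most
   [g + lnbox 3], so Markov's inequality bounds the mass where [d] is large. *)
Lemma Gset_of_gap (w : Omega i0) n q m (eps delta g : R) :
  let N := nprime r Rad w n in let k := ((q + 1) * n)%N in
  let D := delta * (q * n)%:R * ln 2 in
  (0 < q * n)%N ->
  2 ^+ k * (rho w (N + m) * Rad) <= 1 ->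
  HW w (N + m) (2 ^+ k) <= HW w N (2 ^+ n) + Zent w N m (2 ^+ k) + g ->
  3 * lnbox R 1 < D -> g + lnbox R 3 + lnbox R 1 < eps * (D - lnbox R 1) ->
  Gset p t r phi eta Rad eps delta q n w.
Proof.
move=> N k D qn0 small gap D3 geps.
have ln2 : 0 < ln 2 :> R by apply: ln_gt0; rewrite ltr1n.
have b0 := lnbox_ge0 R 1.
have conv_tau := entropy_conv_tau p0 p1 Rad0 r01 phi1 fball eta_lim.
set c := @Defs.pw R I J p w N; set v := @Defs.pw R I J p (iter N T w) m.
have cP : pweight c := pwP w N; have vP : pweight v := pwP (iter N T w) m.
have [c0 c1] := cP.
pose Y := fun a : Xw J w N * Xw J (iter N T w) m =>
  cell (2 ^+ k) (fw a.1 (fw a.2 (czero R))).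
pose Dn := fun u : Xw J w N => cell (2 ^+ n) (fw u (czero R)).
have YE : Y = fun a => cell (2 ^+ k)
    (cadd (fw a.1 (czero R)) (cmul (Lam w N) (fw a.2 (czero R)))).
  by apply/funext => a; rewrite /Y fw_affine.
(* [tau] itself is treated as its convolution with a point mass at zero. *)
have [h0 h0E h0b] : exists2 h0, entropy (tauw r phi eta w N) k = h0%:E &
    `|h0 * ln 2 - Zent w N m (2 ^+ k)| <= lnbox R 1.
  have uP : pweight (fun _ : unit => 1 : R).
    by split=> //; rewrite big_const card_unit /= addr0.
  have [|h0 E0 H0] := conv_tau unit (fun=> 1) (fun=> czero R) w N m k
      (tauw r phi eta w N) uP small.
    move=> ab; rewrite big_const card_unit /= mul1e adde0.
    by congr (tauw _ _ _ _ _ _); apply/funext => z; rewrite /mkset cadd0.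
  exists h0 => //; move: H0; congr (`|_ - _| <= _).
  rewrite (shent_prod2 v uP (fun b => cell (2 ^+ k)
    (cadd (czero R) (cmul (Lam w N) (fw b (czero R)))))).
  by congr shent; apply/funext => b; rewrite cadd0.
pose d u := shent (prodw (cond c Dn (Dn u)) v) Y - Zent w N m (2 ^+ k).
have cgt0 u : 0 < c u by apply: prodr_gt0 => i _; exact: p0.
have condP u : pweight (cond c Dn (Dn u)) := pweight_cond c0 Dn (cgt0 u).
have dlow u : - lnbox R 1 <= d u.
  rewrite /d lerBrDl YE lerBlDr.
  exact: (conv_lower (fun u => fw u (czero R))
    (fun b => cmul (Lam w N) (fw b (czero R))) (2 ^+ k) (condP u) vP).
have dmean : \sum_u c u * d u <= g + lnbox R 3.
  have -> : \sum_u c u * d u =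
      shent (prodw c v) (fun a => (Dn a.1, Y a)) - HW w N (2 ^+ n) - Zent w N m (2 ^+ k).
    rewrite -(shent_mean_cond cP vP Dn Y) /d.
    under eq_bigr do rewrite mulrBr.
    by rewrite sumrB -mulr_suml c1 mul1r.
  have : shent (prodw c v) (fun a => (Dn a.1, Y a)) <= HW w (N + m) (2 ^+ k) + lnbox R 3.
    (* [B = 1] suffices: by the choice of [N], [2^n * rho w N * Rad] is at most one half. *)
    apply: (pair_upper p0 p1 Rad0 r01 phi1 fball m (B := 1)).
    - by rewrite exprn_gt0.
    - by rewrite ler_eXn2l ?ltr1n// /k addn1 leq_pmull.
    - have [H _] := nprimeP Rad0 r01 w n; rewrite -/N in H.
      have X0 : 0 < 2 ^+ n :> R by rewrite exprn_gt0.
      have : 2 ^+ n * (rho w N * Rad) *+ 2 <= 1.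
        rewrite -(ler_pM2l X0) divff ?gt_eqF// in H; apply: le_trans H; rewrite mulr2n.
        rewrite [leRHS](_ : _ = 2 ^+ n * (rho w N * Rad) + 2 ^+ n * (rho w N * Rad))//.
        ring.
      apply: le_trans; rewrite mulr2n lerDl mulr_ge0 ?(ltW X0)//.
      by rewrite mulr_ge0 ?(ltW Rad0)// ltW// rho_gt0.
  lra.
pose A (u : Xw J w N) : Prop := (((q * n)%:R^-1)%:E *
  `|entropy (comp_conv c (fun u => fw u (czero R)) (fw u (czero R)) n
      (tauw r phi eta w N)) k - entropy (tauw r phi eta w N) k| < delta%:E)%E.
suff : 1 - eps < \sum_(u | `[< A u >]) c u by [].
(* Each of the two bridges errs by at most [lnbox R 1], so a bad component has
   [|d u| >= D - 2 * lnbox R 1]; since [D > 3 * lnbox R 1], the lower bound [dlow] excludes the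
   negative sign. *)
have bad u : ~ A u -> D - lnbox R 1 <= d u + lnbox R 1.
  have [|h1 h1E h1b] := conv_tau _ (cond c Dn (Dn u)) (fun u => fw u (czero R)) w N m k
      (comp_conv c (fun u => fw u (czero R)) (fw u (czero R)) n (tauw r phi eta w N))
      (condP u) small.
    move=> ab; rewrite /comp_conv big_mkcond; apply: eq_bigr => u' _; rewrite DsqE /cond.
    rewrite -/(Dn u) -/(Dn u'); case: ifP => _; last by rewrite mul0e.
    congr ((_ / _)%:E * _)%E; rewrite /dmass /prb; apply: eq_bigl => b.
    by rewrite DsqE.
  rewrite /A h1E h0E -EFinB /= -EFinM lte_fin => /negP; rewrite -leNgt.
  have qnR : 0 < (q * n)%:R :> R by rewrite ltr0n.
  rewrite ler_pdivlMl// mulrC => H.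
  have {}H : D <= `|h1 * ln 2 - h0 * ln 2|.
    by rewrite -mulrBl normrM (gtr0_norm ln2) /D ler_pM2r.
  rewrite -YE in h1b.
  have E : h1 * ln 2 - h0 * ln 2 = (h1 * ln 2 - shent (prodw (cond c Dn (Dn u)) v) Y) -
     (h0 * ln 2 - Zent w N m (2 ^+ k)) + d u by rewrite /d; ring.
  have dl := dlow u; move: H; rewrite E.
  move: h1b h0b; rewrite !ler_norml => /andP[? ?] /andP[? ?].
  set z := (X in `|X|); rewrite /z ler_normr => /orP[]; lra.
have Dpos : 0 < D - lnbox R 1 by lra.
have Hbad : \sum_(u | ~~ `[< A u >]) c u < eps.
  rewrite -(ltr_pM2r Dpos); apply: le_lt_trans geps.
  apply: (@le_trans _ _ (\sum_u c u * (d u + lnbox R 1))).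
    rewrite mulr_suml big_mkcond; apply: ler_sum => u _.
    case: asboolP => [_|/bad H] /=; last by rewrite ler_pM2l.
    by rewrite mulr_ge0// -[lnbox R 1]opprK subr_ge0.
  under eq_bigr do rewrite mulrDr.
  by rewrite big_split /= -mulr_suml c1 mul1r lerD2r.
have : \sum_(u | `[< A u >]) c u + \sum_(u | ~~ `[< A u >]) c u = 1.
  by rewrite -c1 [RHS](bigID (fun u => `[< A u >])).
rewrite /c; lra.
Qed.

Definition Jmax : nat := \max_i #|J i|.

Lemma Jmax_gt0 : (0 < Jmax)%N.
Proof.
apply: leq_trans (leq_bigmax i0); rewrite lt0n; apply/eqP => J0.
have := p1 i0; rewrite big_pred0 => [/eqP|j]; first by rewrite eq_sym oner_eq0.
by have := card0_eq J0 j.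
Qed.

Lemma ln_card_Xw (w : nat -> I) d : ln #|Xw J w d|%:R <= d%:R * ln Jmax%:R :> R.
Proof.
have le : (#|Xw J w d| <= Jmax ^ d)%N.
  rewrite card_dep_ffun.
  have gen (l : seq 'I_d) :
      (foldr muln 1 [seq #|J (w (nat_of_ord x))| | x <- l] <= Jmax ^ size l)%N.
    by elim: l => //= i l IH; rewrite expnS leq_mul// leq_bigmax.
  by apply: leq_trans (gen _) _; rewrite -cardE card_ord.
have J1 : 1 <= Jmax%:R :> R by rewrite ler1n Jmax_gt0.
case: (posnP #|Xw J w d|) => [->|X0].
  by rewrite ln0// mulr_ge0// ln_ge0.
rewrite mulr_natl -lnXn ?(lt_le_trans ltr01)// ler_ln ?posrE ?ltr0n//.
  by rewrite -natrX ler_nat.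
by rewrite exprn_gt0// (lt_le_trans ltr01).
Qed.

Lemma sigma_ge0 (w : Omega i0) n : 0 <= sigma w n.
Proof. by have [c0 c1] := pwP w n; exact: shent_ge0. Qed.

Lemma sigma_le (w : Omega i0) n : sigma w n <= n%:R * ln Jmax%:R.
Proof.
apply: le_trans (ln_card_Xw w n); have [c0 c1] := pwP w n.
apply: le_trans (shent_fin c0 c1 id).
by apply: le_shent => // a b ->.
Qed.

Lemma nat_above (x : R) : exists B : nat, x <= B%:R.
Proof.
exists (Num.bound `|x|); apply: le_trans (ler_norm x) _.
by apply/ltW/archi_boundP.
Qed.

Hypothesis rlow : forall i, 1 / 2 < 2 * Rad * r i.

(** From [rlow] and [r i < 1], [2 * Rad > 1/2], so the empty product is already too large.
    Positivity allows rounding [N.-1] down in [gap_bound]. *)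
Lemma nprime_gt0 (w : Omega i0) n : (0 < n)%N -> (0 < nprime r Rad w n)%N.
Proof.
move=> n0; rewrite lt0n; apply/eqP => N0; have [+ _] := nprimeP Rad0 r01 w n.
rewrite N0 /rho big_ord0 mulr1; apply/negP; rewrite -ltNge.
have /andP[ri0 ri1] := r01 i0; have := rlow i0 => H.
have : (2 ^+ n)^-1 <= 1 / 2 :> R.
  rewrite div1r lef_pV2 ?posrE ?exprn_gt0// -[leLHS]expr1 ler_eXn2l//.
  by rewrite ltr1n.
nra.
Qed.

(** [rlow] says [r i > 1 / (4 * Rad)]. This bounds the cost of overshooting a scale by one block. *)
Lemma rho_low (E s : nat) (w : nat -> I) : 4 * Rad <= E%:R -> 1 <= (E ^ s)%:R * rho w s.
Proof.
move=> HE; rewrite natrX -[X in E%:R ^+ X](card_ord s) -prodr_const /rho -big_split /=.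
elim/big_rec: _ => // i x _ x1; rewrite (le_trans x1)// ler_peMl ?(le_trans ler01)//.
have := rlow (w i); have /andP[ri0 _] := r01 (w i); nra.
Qed.

(** Take [L = l.+1 * s], the least multiple of [s] at which the tail is below [2^-k], and [a * s],
    the last multiple before [N]. Then [HW] at [N + m = L] is compared with [sigma w L], the
    hypothesis on increments splits it at [a * s], and both parts are carried to [N], whose distance
    [d] from [a * s] is at most [s]. *)
Lemma gap_bound : exists K1 K2 : R, [/\ 0 <= K1, 0 <= K2 &
  forall (w : Omega i0) n q s l0, (0 < n)%N -> (0 < q)%N -> (0 < s)%N ->
  let N := nprime r Rad w n in let k := ((q + 1) * n)%N in
  2 ^+ k * (rho w (l0 * s) * Rad) <= 1 ->
  (forall a b, (a <= b <= l0)%N ->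
    sigma w (b * s) - sigma w (a * s) - sigma (iter (a * s) T w) ((b - a) * s) <= s%:R) ->
  exists2 m, 2 ^+ k * (rho w (N + m) * Rad) <= 1 &
    HW w (N + m) (2 ^+ k) <= HW w N (2 ^+ n) + Zent w N m (2 ^+ k) + (K1 + s%:R * K2)].
Proof.
have nat3 (c : nat) : (0 < c -> c.*2.+1 <= 3 * c)%N by lia.
have [B1 HB1] := nat_above Rad^-1.
have [B2 HB2] := nat_above (4 * Rad).
have [Bc HBc] := nat_above (1 + 2 * Rad).
have [E HE] := nat_above (1 + 4 * Rad).
have E1 : (1 <= E)%N by rewrite -(ler1n R); move: HE Rad0; lra.
have Bc1 : (1 <= Bc)%N by rewrite -(ler1n R); move: HBc Rad0; lra.
have J0 := Jmax_gt0.
exists (lnbox R B1 + lnbox R B2 + 2 * ln (3 * Bc%:R)), (1 + ln Jmax%:R + 2 * ln E%:R).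
have lnE : 0 <= ln E%:R :> R by rewrite ln_ge0 ?ler1n.
have lnJ : 0 <= ln Jmax%:R :> R by rewrite ln_ge0 ?ler1n.
have lnB : 0 <= ln (3 * Bc%:R) :> R by rewrite ln_ge0// -natrM ler1n muln_gt0.
have [b1 b2] := (lnbox_ge0 R B1, lnbox_ge0 R B2).
split; [lra|lra|move=> w n q s l0 n0 q0 s0 N k small0 dif].
have X0 : 0 < 2 ^+ k :> R by rewrite exprn_gt0.
have ex : exists l, 2 ^+ k * (rho w (l * s) * Rad) <= 1 by exists l0.
case: (ex_minnP ex) => l Hl minl.
have ll0 : (l <= l0)%N by exact: minl.
have Rad4 : 1 < 4 * Rad.
  have := rlow i0; have /andP[? ?] := r01 i0; nra.
have nk : (n < k)%N by rewrite /k addn1 ltn_Pmull.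
case: l => [|l] in Hl minl ll0 *.
  exfalso; move: Hl; rewrite mul0n /rho big_ord0 mul1r; apply/negP; rewrite -ltNge.
  have : 2 ^+ 2 <= 2 ^+ k :> R by rewrite ler_eXn2l ?ltr1n// (leq_ltn_trans n0 nk).
  rewrite expr2; nra.
have Hl' : 1 < 2 ^+ k * (rho w (l * s) * Rad).
  by rewrite ltNge; apply/negP => /minl; rewrite ltnn.
have N0 : (0 < N)%N := nprime_gt0 w n0.
have [HN1 HN2] := nprimeP Rad0 r01 w n; rewrite -/N in HN1 HN2.
(* Otherwise minimality of [N] would give [2^-n < 2 * Rad * rho w L <= 2 * 2^-k <= 2^-n]. *)
have NL : (N <= l.+1 * s)%N.
  rewrite leqNgt; apply/negP => /HN2; apply/negP; rewrite -leNgt.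
  have : 2 ^+ n *+ 2 <= 2 ^+ k :> R.
    by rewrite -mulr_natl -exprS ler_eXn2l ?ltr1n.
  have Y0 : 0 < 2 ^+ n :> R by rewrite exprn_gt0.
  have z0 : 0 < rho w (l.+1 * s) * Rad by rewrite mulr_gt0 ?rho_gt0.
  move=> nk2; rewrite -[leRHS]mulr1 ler_pdivlMl// (le_trans _ Hl)//.
  rewrite [leLHS](_ : _ = 2 ^+ n *+ 2 * (rho w (l.+1 * s) * Rad)); first by rewrite ler_pM2r.
  by rewrite -mulr_natl; ring.
(* [N.-1] makes [a * s < N] strict, so minimality of [N] bounds [rho w (a * s)] from below, while
   [d <= s] still holds. *)
pose a := (N.-1 %/ s)%N; pose d := (N - a * s)%N; pose m := (l.+1 * s - N)%N.
have as_lt : (a * s < N)%N by rewrite (leq_ltn_trans (leq_trunc_div _ _))// prednK.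
have Nd : N = (a * s + d)%N by rewrite /d subnKC// ltnW.
have ds : (d <= s)%N by rewrite /d leq_subLR addnC -mulSn -(prednK N0) ltn_ceil.
have Lm : (N + m)%N = (l.+1 * s)%N by rewrite /m subnKC.
have al : (a <= l.+1)%N by rewrite -(leq_pmul2r s0) (leq_trans (ltnW as_lt) NL).
have dm : ((l.+1 - a) * s)%N = (d + m)%N.
  by rewrite mulnBl /d /m addnC addnBA ?(ltnW as_lt)// subnK.
exists m; first by rewrite Lm.
have C1 : HW w (N + m) (2 ^+ k) <= sigma w (N + m) + lnbox R B1.
  apply: (HW_le_sigma t phi p0 p1 r01) => //; apply: le_trans HB1.
  by rewrite Lm -[leRHS]mul1r ler_pdivlMr// -mulrA.
have C2 : sigma w (a * s) <= HW w N (2 ^+ n) + lnbox R B2.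
  rewrite [X in HW w X]Nd; apply: (sigma_le_HW p0 p1 Rad0 r01 phi1 fball); first by rewrite exprn_gt0.
  have H := HN2 _ as_lt; apply: le_trans HB2.
  rewrite (_ : 4 * Rad = 2 * Rad + Rad *+ 2); last by rewrite -mulr_natl; ring.
  by rewrite lerD2r invfM ler_pdivrMr ?rho_gt0// ltW.
(* Minimality of [l] gives [2^k * rho w (l * s) * Rad > 1], so [Bc >= 1 + 2 * Rad] brings the
   product above 2; [E ^ s] compensates for the last block. *)
have C3 : sigma (iter (a * s) T w) (d + m) <=
    ln #|Xw J (iter (a * s) T w) d|%:R + Zent w N m (2 ^+ k) + lnbox R (Bc * E ^ s).
  rewrite [X in Zent w X]Nd; apply: (sigma_le_split t p0 p1 r01 phi1) => //.
  rewrite -Nd Lm mulSn addnC rho_add natrM.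
  have := @rho_low E s (iter (l * s) T w) _; set e := (_ ^ s)%:R; set z := rho _ s.
  move=> /(_ ltac:(lra)) ez.
  have y0 : 0 < 2 ^+ k * rho w (l * s) by rewrite mulr_gt0 ?rho_gt0.
  rewrite [leRHS](_ : _ = (Bc%:R * (2 ^+ k * rho w (l * s))) * (e * z)); last by ring.
  have H2 : 2 <= Bc%:R * (2 ^+ k * rho w (l * s)) by nra.
  by rewrite (le_trans H2)// ler_peMr// (le_trans _ H2).
have C4 := ln_card_Xw (iter (a * s) T w) d.
have C5 : d%:R * ln Jmax%:R <= s%:R * ln Jmax%:R :> R by rewrite ler_wpM2r// ler_nat.
have C6 : lnbox R (Bc * E ^ s) <= 2 * ln (3 * Bc%:R) + s%:R * (2 * ln E%:R).
  have c1 : (0 < Bc * E ^ s)%N by rewrite muln_gt0 Bc1 expn_gt0 E1.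
  rewrite /lnbox natrX lnXn; last by rewrite ltr0n.
  have : ln ((Bc * E ^ s).*2.+1%:R) <= ln (3 * Bc%:R * E%:R ^+ s) :> R.
    rewrite ler_ln ?posrE ?ltr0n//; last first.
      by rewrite mulr_gt0 ?exprn_gt0 ?ltr0n// mulr_gt0 ?ltr0n.
    by rewrite -natrX -!natrM ler_nat -mulnA; exact: nat3.
  rewrite lnM ?posrE ?mulr_gt0 ?exprn_gt0 ?ltr0n//.
  by rewrite lnXn ?ltr0n// -[ln E%:R *+ s]mulr_natl mulr2n; lra.
have := dif a l.+1; rewrite al ll0 dm -Lm => /(_ isT) C7.
rewrite !mulrDr mulr1; lra.
Qed.

End Gap.

(** * Mean entropies *)

(** [al n - C] is exactly superadditive, so the slope is the supremum of [(al n - C) / n]: it bounds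
    [al] from above up to [C], and repeating one nearly optimal block bounds it from below. *)
Lemma fekete (R : realType) (al : nat -> R) (C c : R) : 0 <= C ->
  (forall n, 0 <= al n <= n%:R * c) ->
  (forall n m, al n + al m <= al (n + m)%N + C) ->
  exists L, forall e, 0 < e -> exists n0, forall n, (n0 <= n)%N ->
    `|al n - L * n%:R| <= e * n%:R.
Proof.
move=> C0 alb supadd.
pose S : set R := [set x | exists2 n, (0 < n)%N & x = (al n - C) / n%:R].
have hS : has_sup S.
  split; first by exists ((al 1%N - C) / 1%:R); exists 1%N.
  exists c => _ [n n0 ->]; rewrite ler_pdivrMr ?ltr0n//.
  by have /andP[_] := alb n; rewrite mulrC; lra.
exists (sup S) => e e0; set L := sup S.
have up n : (0 < n)%N -> al n <= L * n%:R + C.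
  move=> n0; rewrite -lerBlDr -ler_pdivrMr ?ltr0n//.
  by apply: sup_upper_bound => //; exists n.
have e2 : 0 < e / 2 by rewrite divr_gt0.
have [x [N N0 xE] Lx] := sup_adherent e2 hS.
have low a b : a%:R * (al N - C) <= al (a * N + b)%N.
  elim: a => [|a IH]; first by rewrite mul0r; case/andP: (alb (0 * N + b)%N).
  have := supadd N (a * N + b)%N; rewrite addnA -mulSn -natr1 mulrDl mul1r; lra.
have [n1 Hn1] := nat_above (C / e).
have [n2 Hn2] := nat_above (N%:R * `|x| / (e / 2)).
exists (n1 + n2).+1 => n nle.
have n0 : 0 < n%:R :> R by rewrite ltr0n; lia.
have nn1 : n1%:R <= n%:R :> R by rewrite ler_nat; lia.
have nn2 : n2%:R <= n%:R :> R by rewrite ler_nat; lia.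
have en1 : C <= e * n%:R by rewrite mulrC -ler_pdivrMr// (le_trans Hn1).
have en2 : N%:R * `|x| <= e / 2 * n%:R.
  by rewrite [leRHS]mulrC -ler_pdivrMr// (le_trans Hn2).
have U := up n (leq_ltn_trans (leq0n _) nle).
have := low (n %/ N)%N (n %% N)%N; rewrite -divn_eq.
have -> : al N - C = N%:R * x by rewrite xE mulrC divfK// gt_eqF// ltr0n.
rewrite mulrA -natrM => Lo.
have Lo2 : n%:R * x - N%:R * `|x| <= (n %/ N * N)%:R * x.
  rewrite {1}(divn_eq n N) natrD mulrDl -addrA gerDl subr_le0.
  apply: le_trans (_ : (n %% N)%:R * `|x| <= _); first by rewrite ler_wpM2l// ler_norm.
  by rewrite ler_wpM2r// ler_nat ltnW// ltn_mod.
have Lo3 : (L - e / 2) * n%:R <= n%:R * x by rewrite [leRHS]mulrC ler_pM2r// ltW.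
rewrite ler_norml; apply/andP; split; nra.
Qed.

Section Mean.
Variables (R : realType) (I : finType) (i0 : I) (J : I -> finType).
Variables (p : forall i, J i -> R) (t : forall i, J i -> R * R)
          (r : I -> R) (phi : I -> R * R) (Rad : R).
Variable P : probability (Omega i0) R.

Local Notation T := (@shift I i0).
Local Notation fmp := (fmp t r phi).
Local Notation sigma := (sigma p t r phi).

Hypothesis p0 : forall i (j : J i), 0 < p j.
Hypothesis p1 : forall i, \sum_(j : J i) p j = 1.
Hypothesis Rad0 : 0 < Rad.
Hypothesis r01 : forall i, 0 < r i < 1.
Hypothesis phi1 : forall i, cnorm (phi i) = 1.
Hypothesis fball : forall i (j : J i) z, cnorm z < Rad -> cnorm (fmp j z) < Rad.
Hypothesis PT : T_invariant P.

Lemma P_iter_shift n (A : set (Omega i0)) : measurable A -> P (iter n T @^-1` A) = P A.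
Proof.
elim: n A => [//|n IH] A mA.
have mTA : measurable (T @^-1` A).
  by rewrite -[X in measurable X]setTI; exact: measurable_shift.
by rewrite -(PT mA) -(IH _ mTA).
Qed.

Lemma integral_cst1 (c : R) : (\int[P]_w (cst c%:E w) = c%:E)%E.
Proof.
apply: etrans (integral_cst P measurableT c%:E) _.
apply: etrans (congr1 (fun x => c%:E * x)%E (probability_setT P)) _.
exact: mule1.
Qed.

Lemma measurable_sigma n : measurable_fun setT (fun w : Omega i0 => sigma w n).
Proof.
by apply: (measurable_fun_prefix (n := n)) => w w'; exact: sigma_prefix.
Qed.

Definition msigma n : R := fine (\int[P]_w (sigma w n)%:E)%E.

Let s0 (w : Omega i0) n : 0 <= sigma w n := sigma_ge0 t r phi p0 p1 w n.
Let sle (w : Omega i0) n : sigma w n <= n%:R * ln (Jmax J)%:R.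
Proof. exact: (sigma_le t r phi p0 p1). Qed.

Lemma integral_sigma n : (\int[P]_w (sigma w n)%:E)%E = (msigma n)%:E.
Proof.
rewrite /msigma fineK// ge0_fin_numE; last by apply: integral_ge0 => w _; rewrite lee_fin.
apply: (@le_lt_trans _ _ (\int[P]_w (cst (n%:R * ln (Jmax J)%:R)%:E w))%E).
  apply: ge0_le_integral => //=.
  - by move=> w _; rewrite lee_fin; exact: s0.
  - apply/measurable_EFinP; exact: measurable_sigma.
  - by move=> w _; rewrite lee_fin; exact: sle.
by rewrite integral_cst1 ltry.
Qed.

Lemma integral_sigma_shift n m :
  (\int[P]_w (sigma (iter n T w) m)%:E)%E = (msigma m)%:E.
Proof.
rewrite -integral_sigma.
have mT := @measurable_iter_shift I i0 n.
have mE : measurable_fun setT (fun w : Omega i0 => (sigma w m)%:E).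
  by apply/measurable_EFinP; exact: measurable_sigma.
have E0 : {in [set: Omega i0], forall w, (0 <= (sigma w m)%:E)%E}.
  by move=> w _; rewrite lee_fin; exact: s0.
apply: etrans (esym (ge0_integral_pushforward mT P measurableT mE E0)) _.
by apply: eq_measure_integral => A mA _; exact: P_iter_shift.
Qed.

Lemma msigma_bound n : 0 <= msigma n <= n%:R * ln (Jmax J)%:R.
Proof.
apply/andP; split; rewrite -lee_fin -integral_sigma.
  by apply: integral_ge0 => w _; rewrite lee_fin.
rewrite -[leRHS]integral_cst1.
apply: ge0_le_integral => //=.
- by move=> w _; rewrite lee_fin; exact: s0.
- apply/measurable_EFinP; exact: measurable_sigma.
- by move=> w _; rewrite lee_fin; exact: sle.
Qed.

Definition jump n m (x : R) : set (Omega i0) :=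
  [set w | x < sigma w (n + m) - sigma w n - sigma (iter n T w) m].

Lemma measurable_jump n m x : measurable (jump n m x).
Proof.
apply: (measurable_prefix (n := n + m)) => w w' ww'; rewrite /jump /=.
rewrite (sigma_prefix p t r phi ww').
rewrite (sigma_prefix p t r phi (w := w) (w' := w') (n := n)); last first.
  by move=> i im; apply: ww'; exact: ltn_addr.
rewrite (sigma_prefix p t r phi (w := iter n T w) (w' := iter n T w'))//.
by move=> i im; rewrite !iter_shift; apply: ww'; rewrite ltn_add2l.
Qed.

(** Markov's inequality for the defect: pointwise, [x] times the indicator of the jump plus the two
    entropies is at most [sigma w (n + m) + C], on the jump by definition and off it by
    superadditivity. Invariance integrates the shifted term. The case [x = 0] makes [msigma]
    superadditive. *)
Lemma msigma_jump n m (x : R) (B : nat) : 0 <= x -> Rad <= B%:R ->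
  x * fine (P (jump n m x)) + msigma n + msigma m <=
  msigma (n + m) + (lnbox R 1 + lnbox R 2 + lnbox R (B.*2.+1)).
Proof.
move=> x0 RB; set C := lnbox R 1 + _ + _.
have C0 : 0 <= C by rewrite !addr_ge0 ?lnbox_ge0.
have sC (w : Omega i0) : sigma w n + sigma (iter n T w) m <= sigma w (n + m) + C.
  exact: (sigma_superadd p0 p1 Rad0 r01 phi1 fball w n m RB).
clearbody C; have mj := measurable_jump n m x.
have mT : measurable_fun setT (fun w : Omega i0 => sigma (iter n T w) m).
  exact: (measurableT_comp (measurable_sigma m) (@measurable_iter_shift I i0 n)).
have ms := measurable_sigma.
pose f1 w := (x%:E * (\1_(jump n m x) w)%:E)%E.
pose f2 (w : Omega i0) := (sigma w n)%:E; pose f3 (w : Omega i0) := (sigma (iter n T w) m)%:E.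
pose f4 (w : Omega i0) := (sigma w (n + m))%:E; pose f5 := cst C%:E : Omega i0 -> \bar R.
have f10 w : [set: Omega i0] w -> (0 <= f1 w)%E.
  by move=> _; rewrite mule_ge0// lee_fin.
have f20 w : [set: Omega i0] w -> (0 <= f2 w)%E by move=> _; rewrite lee_fin; exact: s0.
have f30 w : [set: Omega i0] w -> (0 <= f3 w)%E by move=> _; rewrite lee_fin; exact: s0.
have f40 w : [set: Omega i0] w -> (0 <= f4 w)%E by move=> _; rewrite lee_fin; exact: s0.
have f50 w : [set: Omega i0] w -> (0 <= f5 w)%E by move=> _; rewrite lee_fin.
have m0 : measurable_fun setT (fun w => (\1_(jump n m x) w)%:E : \bar R).
  by apply/measurable_EFinP; exact: measurable_indic.
have m1 : measurable_fun setT f1 by apply: emeasurable_funM.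
have m2 : measurable_fun setT f2 by apply/measurable_EFinP; exact: ms.
have m3 : measurable_fun setT f3 by apply/measurable_EFinP; exact: mT.
have m4 : measurable_fun setT f4 by apply/measurable_EFinP; exact: ms.
have m5 : measurable_fun setT f5 by exact: measurable_cst.
have f120 w : [set: Omega i0] w -> (0 <= f1 w + f2 w)%E.
  by move=> wT; rewrite adde_ge0 ?f10 ?f20.
have m12 : measurable_fun setT (fun w => f1 w + f2 w)%E by exact: emeasurable_funD.
have I1 : (\int[P]_w f1 w = (x * fine (P (jump n m x)))%:E)%E.
  have i0' w : [set: Omega i0] w -> (0 <= (\1_(jump n m x) w)%:E :> \bar R)%E.
    by move=> _; rewrite lee_fin.
  rewrite (ge0_integralZl_EFin P measurableT i0' m0 x0) (integral_indic P measurableT mj).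
  by rewrite setIT EFinM fineK// fin_num_measure.
have I12 := ge0_integralD P measurableT f10 m1 f20 m2.
have I123 := ge0_integralD P measurableT f120 m12 f30 m3.
have I45 := ge0_integralD P measurableT f40 m4 f50 m5.
rewrite -lee_fin !EFinD -I1 -(integral_sigma n) -(integral_sigma_shift n m).
rewrite -(integral_sigma (n + m)) -(integral_cst1 C) -I12 -I123 -I45.
apply: ge0_le_integral => //.
- by move=> w wT; rewrite adde_ge0 ?f120 ?f30.
- exact: emeasurable_funD.
- exact: emeasurable_funD.
move=> w _; rewrite /f1 /f2 /f3 /f4 /f5 /= -EFinM -!EFinD lee_fin indicE.
case: (boolP (w \in jump n m x)) => [|_].
  by rewrite inE /jump /= mulr1; lra.
by rewrite mulr0 add0r; exact: sC.
Qed.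

Lemma jump_small (e : R) (l : nat) : 0 < e -> exists s1, forall s, (s1 <= s)%N ->
  forall a b, (a <= b <= l)%N -> fine (P (jump (a * s) ((b - a) * s) s%:R)) <= e.
Proof.
move=> e0; have [B HB] := nat_above Rad.
set C := lnbox R 1 + lnbox R 2 + lnbox R (B.*2.+1).
have C0 : 0 <= C by rewrite !addr_ge0 ?lnbox_ge0.
have mj n m x : 0 <= x -> x * fine (P (jump n m x)) + msigma n + msigma m <=
  msigma (n + m) + C by move=> x0; exact: msigma_jump.
clearbody C.
have [n m|L HL] := fekete C0 msigma_bound.
  by have := mj n m 0 (lexx _); rewrite mul0r add0r.
(* The deviations from linearity at [b * s], [a * s] and [(b - a) * s] add up to at most
   [2 * fe * b * s <= e * s / 2]; the other half absorbs [C]. *)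
pose fe := e / (4 * l.+1%:R).
have l1 : 0 < l.+1%:R :> R by rewrite ltr0n.
have fe0 : 0 < fe by rewrite divr_gt0// mulr_gt0.
have feE : fe * (4 * l.+1%:R) = e by rewrite divfK// gt_eqF// mulr_gt0.
have [n0 Hn0] := HL _ fe0; have [S HS] := nat_above (2 * C / e).
exists (n0 + S).+1 => s sle' a b /andP[ab bl].
have n0s : (n0 <= s)%N by apply: leq_trans (leqW (leq_addr S n0)) sle'.
have sS : S%:R <= s%:R :> R.
  by rewrite ler_nat; apply: leq_trans (leqW (leq_addl n0 S)) sle'.
have spos : 0 < s%:R :> R by rewrite ltr0n; apply: leq_trans sle'.
have hal j : `|msigma (j * s) - L * (j%:R * s%:R)| <= fe * (j%:R * s%:R).
  (* Time zero is below the threshold [n0], but [msigma 0 = 0]. *)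
  case: j => [|j].
    rewrite mul0n !mul0r !mulr0 subr0; have := msigma_bound 0.
    by rewrite mul0r -eq_le => /eqP <-; rewrite normr0.
  by rewrite -natrM; apply: Hn0; apply: leq_trans n0s _; rewrite mulSn leq_addr.
have Jm := mj (a * s)%N ((b - a) * s)%N s%:R (ltW spos).
rewrite -mulnDl subnKC// in Jm.
have := hal a; have := hal b; have := hal (b - a)%N; rewrite natrB// !ler_norml.
move=> /andP[c1 c2] /andP[b1 b2] /andP[a1 a2].
have bl' : b%:R <= l.+1%:R :> R by rewrite ler_nat leqW.
have Cs : 2 * C <= e * s%:R.
  by rewrite [leRHS]mulrC -ler_pdivrMr//; exact: le_trans HS sS.
rewrite -(ler_pM2l spos).
have fbs : fe * (b%:R * s%:R) <= fe * (l.+1%:R * s%:R) by rewrite ler_pM2l// ler_pM2r.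
have fls : fe * (l.+1%:R * s%:R) *+ 4 = e * s%:R.
  by rewrite -[in RHS]feE -mulr_natl; ring.
rewrite -mulr_natl in fls.
have E1 : L * ((b%:R - a%:R) * s%:R) = L * (b%:R * s%:R) - L * (a%:R * s%:R) by ring.
have E2 : fe * ((b%:R - a%:R) * s%:R) = fe * (b%:R * s%:R) - fe * (a%:R * s%:R) by ring.
rewrite E1 E2 in c1 c2.
rewrite [leRHS]mulrC; lra.
Qed.

End Mean.

(** * Union bound over block pairs and conclusion *)

Lemma measure_bigsetU_le (d : measure_display) (S : measurableType d) (R : realType)
    (mu : {measure set S -> \bar R}) (K : Type) (l : seq K) (F : K -> set S) :
  (forall i, measurable (F i)) ->
  (mu (\big[setU/set0]_(i <- l) F i) <= \sum_(i <- l) mu (F i))%E.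
Proof.
move=> mF; elim: l => [|i l IH]; first by rewrite !big_nil measure0.
rewrite !big_cons; apply: le_trans (measureU2 _ _ _) _ => //.
  exact: bigsetU_measurable.
exact: leeD2l.
Qed.

(** Any [e1] consecutive letters contract by at least one half, whatever the sequence. Linearity in
    [k] is what lets a fixed number of blocks of length about [n / B] suffice. *)
Lemma rho_dyadic (R : realType) (I : finType) (i0 : I) (r : I -> R) (Rad : R) :
  0 < Rad -> (forall i, 0 < r i < 1) ->
  exists e1 e0, forall (w : Omega i0) k m, (e1 * k + e0 <= m)%N ->
    2 ^+ k * (rho r w m * Rad) <= 1.
Proof.
move=> Rad0 r01.
have [e1 He1] := rho_lt i0 r01 (divr_gt0 ltr01 (ltr0n R 2)).
have [e0 He0] := rho_lt i0 r01 (divr_gt0 ltr01 Rad0).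
exists e1, e0 => w k m km.
have H1 (w' : Omega i0) : 2 ^+ k * rho r w' (e1 * k) <= 1.
  elim: k w' {km} => [|k IH] w'; first by rewrite muln0 /rho big_ord0 expr0 mulr1.
  rewrite mulnS rho_add exprS.
  have := IH (iter e1 (@shift I i0) w'); have := He1 w'.
  have := rho_gt0 r01 w' e1; set x := rho _ _ e1; set y := rho _ _ (e1 * k).
  move=> x0 x1 H.
  rewrite (_ : 2 * 2 ^+ k * (x * y) = (2 * x) * (2 ^+ k * y)); last by ring.
  have y0 : 0 <= 2 ^+ k * y by rewrite mulr_ge0 ?exprn_ge0// ltW// rho_gt0.
  nra.
rewrite -(subnKC km) -addnA !rho_add.
set w1 := iter _ _ _; set w2 := iter _ _ _.
have := H1 w; have := He0 w1; rewrite ltr_pdivlMr// => A B.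
have c0 := rho_gt0 r01 w2 (m - (e1 * k + e0)).
have c1 := rho_le1 r01 w2 (m - (e1 * k + e0)).
have b0 := rho_gt0 r01 w1 e0; have a0 := rho_gt0 r01 w (e1 * k).
have X0 : 0 < 2 ^+ k :> R by rewrite exprn_gt0.
move: A B c0 c1 b0 a0; set z := rho _ w2 _; set y := rho _ w1 _; set x := rho _ w _.
move=> A B c0 c1 b0 a0.
rewrite (_ : _ * _ = (2 ^+ k * x) * (y * Rad) * z); last by ring.
have u0 : 0 <= 2 ^+ k * x by rewrite mulr_ge0 ?ltW.
have v0 : 0 <= y * Rad by rewrite mulr_ge0 ?ltW.
by rewrite mulr_ile1 ?(mulr_ge0 u0 v0) ?(ltW c0)// mulr_ile1// ltW.
Qed.

Theorem proposition4p2 (R : realType) (I : finType) (i0 : I) (J : I -> finType)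
  (p : forall i, J i -> R) (t : forall i, J i -> R * R)
  (r : I -> R) (phi : I -> R * R) (Rad : R)
  (eta : Omega i0 -> probability (R * R)%type R)
  (P : probability (Omega i0) R) :
  (forall i, 0 < r i < 1) ->
  (forall i, cnorm (phi i) = 1) ->
  (forall i (j : J i), 0 < p i j) ->
  (forall i, \sum_(j : J i) p i j = 1) ->
  0 < Rad ->
  (forall i (j : J i),
     closure (fmp t r phi j @` eball0 Rad) `<=` eball0 Rad) ->
  (forall i, 1 / 2 < 2 * Rad * r i) ->
  is_eta p t r phi eta ->
  T_invariant P ->
  ergodic P ->
  forall (eps delta : R), 0 < eps -> 0 < delta ->
  forall q : nat, (0 < q)%N ->
    P (Gset p t r phi eta Rad eps delta q n) @[n --> \oo] --> 1%E.
Proof.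
move=> r01 phi1 p0 p1 Rad0 hcl rlow eta_lim PT _ eps delta eps0 delta0 q q0.
have fball i (j : J i) z : cnorm z < Rad -> cnorm (fmp t r phi j z) < Rad.
  by move=> zR; apply: (hcl i j); apply: subset_closure; exists z.
have mG n : measurable (Gset p t r phi eta Rad eps delta q n).
  exact: (measurable_Gset p0 p1 Rad0 r01 eta_lim).
suff key e : 0 < e -> exists n0, forall n, (n0 <= n)%N ->
    1 - e <= fine (P (Gset p t r phi eta Rad eps delta q n)).
  apply/fine_cvgP; split; first by apply: nearW => n; exact: fin_num_measure.
  apply/cvgrPdist_le => e e0; have [n0 H] := key e e0; exists n0 => // n /= /H H1.
  have H2 : fine (P (Gset p t r phi eta Rad eps delta q n)) <= 1.
    by rewrite -lee_fin fineK ?fin_num_measure// probability_le1.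
  by rewrite /comp ger0_norm ?subr_ge0//; lra.
move=> e0.
have [K1 [K2 [K10 K20 gap]]] := gap_bound i0 p0 p1 Rad0 r01 phi1 fball rlow.
have [e1 [e2 small]] := rho_dyadic i0 Rad0 r01.
have ln2 : 0 < ln 2 :> R by apply: ln_gt0; rewrite ltr1n.
pose Dq := delta * q%:R * ln 2.
have Dq0 : 0 < Dq by rewrite !mulr_gt0 ?ltr0n.
have X0 : 0 < eps * Dq by rewrite mulr_gt0.
(* With [s] about [n / B], this [B] keeps the rounding cost [s * K2] within [K2] plus half of the
   allowance [eps * Dq * n]. *)
have [B HB] := nat_above (1 + 2 * K2 / (eps * Dq)).
have B1 : 1 <= B%:R :> R.
  by apply: le_trans HB; rewrite lerDl divr_ge0 ?mulr_ge0 ?(ltW X0)// ltW.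
have B0 : (0 < B)%N by rewrite -(ler1n R).
have HB2 : 2 * K2 <= B%:R * (eps * Dq).
  by rewrite -ler_pdivrMr//; apply: le_trans HB; rewrite lerDr.
(* Since [n <= B * s], [l0] blocks reach the scale [2^-((q+1)n)]; it is fixed before [n], as
   [jump_small] requires. *)
pose l0 := (B * (e1 * (q + 1) + e2))%N.
pose O := ('I_l0.+1 * 'I_l0.+1)%type.
have O0 : 0 < #|{: O}|%:R :> R by rewrite ltr0n card_prod !card_ord muln_gt0.
have [s1 Hs1] := jump_small p0 p1 Rad0 r01 phi1 fball PT l0 (divr_gt0 e0 O0).
(* [n1] makes [D] exceed [3 * lnbox R 1], and [n2] absorbs all bounded terms into the other half of
   the allowance; the added ones give strictness. *)
have [n1 Hn1] := nat_above ((3 * lnbox R 1 + 1) / Dq).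
have [n2 Hn2] := nat_above
  (2 * (K1 + K2 + lnbox R 3 + lnbox R 1 + eps * lnbox R 1 + 1) / (eps * Dq)).
exists (B * s1 + n1 + n2).+1 => n nle.
have n0 : (0 < n)%N by apply: leq_trans nle.
have ns1 : (B * s1 <= n)%N.
  by apply: leq_trans (leqW _) nle; rewrite -addnA leq_addr.
have nn1 : n1%:R <= n%:R :> R.
  by rewrite ler_nat; apply: leq_trans (leqW _) nle; rewrite addnAC leq_addl.
have nn2 : n2%:R <= n%:R :> R.
  by rewrite ler_nat; apply: leq_trans (leqW _) nle; rewrite leq_addl.
pose s := (n %/ B).+1.
have s1s : (s1 <= s)%N by rewrite leqW// leq_divRL// mulnC.
have ls : (e1 * ((q + 1) * n) + e2 <= l0 * s)%N.
  have nB : (n <= B * s)%N by rewrite mulnC ltnW// ltn_ceil.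
  apply: (@leq_trans ((e1 * (q + 1) + e2) * n)).
    by rewrite [leqRHS]mulnDl mulnA leq_add2l leq_pmulr.
  by rewrite /l0 mulnAC [leqRHS]mulnC leq_mul2l nB orbT.
pose bad (o : O) : set (Omega i0) := if (o.1 <= o.2)%N
  then jump p t r phi (o.1 * s) ((o.2 - o.1) * s) s%:R else set0.
have mbad o : measurable (bad o).
  by rewrite /bad; case: ifP => // _; exact: measurable_jump.
have Pbad o : (P (bad o) <= (e / #|{: O}|%:R)%:E)%E.
  rewrite /bad; case: ifP => ab; last by rewrite measure0 lee_fin divr_ge0// ltW.
  rewrite -(@fineK _ (P _)); last by apply: fin_num_measure; exact: measurable_jump.
  by rewrite lee_fin; apply: Hs1 => //; rewrite ab -ltnS ltn_ord.
set G := Gset p t r phi eta Rad eps delta q n.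
have cover : [set: Omega i0] `<=` G `|` \big[setU/set0]_(o : O) bad o.
  move=> w _; have [Gw|nG] := pselect (G w); [by left|right].
  apply: contrapT => nbad; apply: nG.
  have good a b : (a <= b <= l0)%N ->
      sigma p t r phi w (b * s) - sigma p t r phi w (a * s) -
      sigma p t r phi (iter (a * s) (@shift I i0) w) ((b - a) * s) <= s%:R.
    move=> /andP[ab bl]; rewrite leNgt; apply/negP => H; apply: nbad.
    have al : (a < l0.+1)%N by rewrite ltnS (leq_trans ab).
    rewrite -bigcup_seq; exists (Ordinal al, Ordinal (bl : (b < l0.+1)%N)) => /=.
      by rewrite mem_index_enum.
    by rewrite /bad /= ab /jump /= -mulnDl subnKC.
  have [m Hm1 Hm2] := gap w n q s l0 n0 q0 (ltn0Sn _) (small w _ _ ls) good.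
  have DE : delta * (q * n)%:R * ln 2 = Dq * n%:R by rewrite /Dq natrM; ring.
  apply: (Gset_of_gap p0 p1 Rad0 r01 phi1 fball eta_lim _ Hm1 Hm2).
  - by rewrite muln_gt0 q0.
  - rewrite DE; apply: lt_le_trans (_ : Dq * n1%:R <= _); last by rewrite ler_pM2l.
    have : 3 * lnbox R 1 + 1 <= Dq * n1%:R by rewrite [leRHS]mulrC -ler_pdivrMr.
    by lra.
  - rewrite DE mulrBr mulrA.
    have sB : s%:R * K2 <= K2 + n%:R * (eps * Dq) / 2.
      have : (n %/ B)%:R * B%:R <= n%:R :> R by rewrite -natrM ler_nat leq_trunc_div.
      rewrite /s -natr1; set y := (n %/ B)%:R => yB.
      have y0 : 0 <= y by rewrite ler0n.
      have H1 : y * (2 * K2) <= y * (B%:R * (eps * Dq)) by rewrite ler_wpM2l.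
      have H2 : y * B%:R * (eps * Dq) <= n%:R * (eps * Dq) by rewrite ler_pM2r.
      by rewrite -mulrA in H2; move: H1 H2; lra.
    have : 2 * (K1 + K2 + lnbox R 3 + lnbox R 1 + eps * lnbox R 1 + 1) <=
        n%:R * (eps * Dq) by rewrite -ler_pdivrMr//; exact: le_trans Hn2 nn2.
    by rewrite [eps * Dq * n%:R]mulrC; lra.
have PU : (P (\big[setU/set0]_(o : O) bad o) <= e%:E)%E.
  apply: le_trans (measure_bigsetU_le P _ mbad) _.
  apply: (@le_trans _ _ (\sum_(o : O) (e / #|{: O}|%:R)%:E)%E).
    by apply: lee_sum => o _; exact: Pbad.
  by rewrite sumEFin lee_fin sumr_const -[X in X <= _]mulr_natr divfK// gt_eqF.
have mU : measurable (\big[setU/set0]_(o : O) bad o) by exact: bigsetU_measurable.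
have : (1 <= P G + e%:E)%E.
  rewrite -(probability_setT P); apply: (@le_trans _ _ (P (G `|` \big[setU/set0]_(o : O) bad o))).
    by rewrite le_measure ?inE//; apply: measurableU; [exact: mG|exact: mU].
  by apply: le_trans (measureU2 _ (mG n) mU) _; exact: leeD2l.
rewrite -(@fineK _ (P G)) ?fin_num_measure//; last exact: mG.
by rewrite -EFinD lee_fin; lra.
Qed.
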